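(* Let $\mathcal{A}$ be a non-degenerate ergodic Markovian automaton on $\tilde A$, without a cycle of probability $1$, with support consisting of reduced words, and with coincidence probability $\alpha_{[2]}$. Let $\lambda\in(0,\frac12)$ and $d\in(0,\frac\lambda2)$. A tuple of cyclically reduced words of length $n$ taken independently and randomly according to $\mathcal{A}$, at $\alpha_{[2]}$-density $d$ (that is, a tuple of $\alpha_{[2]}^{-dn}$ words), exponentially generically (as $n\to\infty$) satisfies the small cancellation property $C'(\lambda)$.
   Context: $A$ is a finite non-empty alphabet, $\tilde A=A\sqcup A^{-1}$. A word over $\tilde A$ is reduced if it has no factor $aa^{-1}$ ($a\in\tilde A$), and cyclically reduced if it is non-empty, reduced and its first and last letters are not mutually inverse. $\mathcal{C}_n$ is the set of cyclically reduced words of length $n$. A Markovian automaton $\mathcal{A}$ on $\tilde A$ consists of: a deterministic transition system $(Q,\cdot)$ with $Q$ a finite non-empty set of states and, for each $q\in Q$, $a\in\tilde A$, either $q\cdot a\in Q$ or $q\cdot a$ undefined; an initial probability vector $\gamma_0\in[0,1]^Q$, $\sum_q\gamma_0(q)=1$; and for each $p\in Q$ a probability vector $(\gamma(p,a))_{a\in\tilde A}$ with $\gamma(p,a)=0$ if and only if $p\cdot a$ is undefined. For a word $u=x_0\cdots x_n$, $\gamma(q,u)=\gamma(q,x_0)\gamma(q\cdot x_0,x_1)\cdots\gamma(q\cdot(x_0\cdots x_{n-1}),x_n)$, and $\gamma_0(u)=\sum_{q}\gamma_0(q)\gamma(q,u)$. The measure $\mathbb{R}_n$ on words of length $n$ is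 $\mathbb{R}_n(u)=\gamma_0(u)$; it is assumed that all words $u$ with $\gamma_0(u)\ne0$ are reduced. A cyclically reduced word of length $n$ is taken randomly according to $\mathcal{A}$ if it has law $\mathbb{R}_n(\cdot\mid\mathcal{C}_n)$ (defined for $n$ large enough). A cycle of probability $1$ is a state $q$ and a non-empty word $u$ with $q\cdot u=q$ and $\gamma(q,u)=1$. Let $M(p,q)=\sum_{a:\,p\cdot a=q}\gamma(p,a)$. $\mathcal{A}$ is ergodic if its transition graph is strongly connected and, for all large enough $n$, $M^n(q,q)>0$ for each $q$; its stationary vector $\tilde\gamma$ is the unique probability vector with $\tilde\gamma M=\tilde\gamma$. For $a\in\tilde A$ write $\gamma_0(a)=\sum_q\gamma_0(q)\gamma(q,a)$ and $\tilde\gamma(a)=\sum_q\tilde\gamma(q)\gamma(q,a)$. $\mathcal{A}$ is non-degenerate if $\sum_{a\in\tilde A}\gamma_0(a)\tilde\gamma(a^{-1})\ne1$. Coincidence probability: let $Q'=\{(q,a)\in Q\times\tilde A:\exists p\in Q,\ p\cdot a=q\}$ and let $\mathbb{M}$ be the $Q'\times Q'$ matrix with $\mathbb{M}((p,a),(q,b))=\gamma(p,b)$ if $p\cdot b=q$ and $0$ otherwise. Let $\mathbb{M}_{[2]}$ be obtained by squaring each entry. Then $\alpha_{[2]}$ is the largest eigenvalue (spectral radius) of $\mathbb{M}_{[2]}$. For a tuple $\vec h=(h_1,\dots,h_k)$ of cyclically reduced words, $\vec h^\pm=(h_1,h_1^{-1},\dots,h_k,h_k^{-1})$; a piece is a word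 $u$ with at least two occurrences as a prefix of a cyclic conjugate of an entry of $\vec h^\pm$ (an occurrence is given by an index in $\vec h^\pm$ and a cyclic starting position). $\vec h$ satisfies $C'(\lambda)$ if whenever a piece $u$ occurs as a prefix of a cyclic conjugate $w$ of an entry of $\vec h^\pm$, then $|u|<\lambda|w|$. A property holds exponentially generically if its failure probability is $o(e^{-cn})$ for some $c>0$. Non-integer sizes are understood as their integer parts. *)

(* Defs.v *)
From HB Require Import structures.
From mathcomp Require Import all_boot all_order all_algebra.
From mathcomp Require Import complex.
From mathcomp Require Import all_classical all_reals all_analysis.

Set Implicit Arguments.
Unset Strict Implicit.
Unset Printing Implicit Defensive.

Import Order.TTheory GRing.Theory Num.Theory.
Import numFieldNormedType.Exports.

Local Open Scope classical_set_scope.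
Local Open Scope ring_scope.

(* [inl a] is the letter a and [inr a] its formal inverse. *)
Definition letter (A : finType) : finType := (A + A)%type.

Definition word (A : finType) := seq (letter A).

Definition linv (A : finType) (x : letter A) : letter A :=
  match x with inl a => inr a | inr a => inl a end.

Definition winv (A : finType) (u : word A) : word A := rev (map (@linv A) u).

Definition reduced (A : finType) (u : word A) : bool :=
  [forall a : letter A, ~~ infix [:: a; linv a] u].

Definition cyc_reduced (A : finType) (u : word A) : bool :=
  match u with
  | [::] => false
  | x :: v => reduced u && (last x v != linv x)
  end.

Record markov_automaton (R : realType) (A Q : finType) := MarkovAutomaton {
  trans : Q -> letter A -> option Q;
  init : Q -> R;
  prob : Q -> letter A -> R;
  init_ge0 : forall q, 0 <= init q;
  init_sum1 : \sum_q init q = 1;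
  prob_ge0 : forall p a, 0 <= prob p a;
  prob_sum1 : forall p, \sum_a prob p a = 1;
  prob_eq0 : forall p a, prob p a = 0 <-> trans p a = None
}.

Section Automaton.
Context {R : realType} {A Q : finType} (M : markov_automaton R A Q).

Fixpoint run (q : Q) (u : word A) : option Q :=
  match u with
  | [::] => Some q
  | a :: v => if trans M q a is Some q' then run q' v else None
  end.

Fixpoint prob_word (q : Q) (u : word A) : R :=
  match u with
  | [::] => 1
  | a :: v =>
      prob M q a * (if trans M q a is Some q' then prob_word q' v else 0)
  end.

Definition init_word (u : word A) : R := \sum_q init M q * prob_word q u.

Definition reduced_support : Prop :=
  forall u : word A, init_word u != 0 -> reduced u.

Definition has_prob1_cycle : Prop :=
  exists (q : Q) (u : word A),
    [/\ u != [::], run q u = Some q & prob_word q u = 1].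

Definition trans_prob (p q : Q) : R :=
  \sum_(a | trans M p a == Some q) prob M p a.

Definition trans_mx : 'M[R]_#|Q| :=
  \matrix_(i, j) trans_prob (enum_val i) (enum_val j).

Definition edge : rel Q := fun p q => [exists a, trans M p a == Some q].

Definition ergodic : Prop :=
  (forall p q : Q, connect edge p q) /\
  \forall n \near \oo, forall i : 'I_#|Q|, 0 < (trans_mx ^+ n) i i.

Definition stationary (g : 'rV[R]_#|Q|) : Prop :=
  [/\ forall i, 0 <= g ord0 i, \sum_i g ord0 i = 1 & g *m trans_mx = g].

Definition init_letter (a : letter A) : R := \sum_q init M q * prob M q a.

Definition stat_letter (g : 'rV[R]_#|Q|) (a : letter A) : R :=
  \sum_q g ord0 (enum_rank q) * prob M q a.

(* [g] is meant to be the stationary vector of the automaton. *)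
Definition non_degenerate (g : 'rV[R]_#|Q|) : Prop :=
  \sum_a init_letter a * stat_letter g (linv a) != 1.

Definition ext_state : finType :=
  {x : Q * letter A | [exists p, trans M p x.2 == Some x.1]}.

Definition ext_prob (x y : ext_state) : R :=
  if trans M (val x).1 (val y).2 == Some (val y).1
  then prob M (val x).1 (val y).2 else 0.

Definition ext_mx2 : 'M[R]_#|ext_state| :=
  \matrix_(i, j) ext_prob (enum_val i) (enum_val j) ^+ 2.

End Automaton.

(* The supremum is a maximum as soon as 0 < n. *)
Definition spectral_radius (R : realType) (n : nat) (B : 'M[R]_n) : R :=
  sup [set complex.Re `|z|
      | z in [set z : complex R |
               eigenvalue (map_mx (real_complex R) B) z]].

Definition coincidence (R : realType) (A Q : finType)
    (M : markov_automaton R A Q) : R := spectral_radius (ext_mx2 M).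

(* (h_1, h_1^-1, ..., h_k, h_k^-1) *)
Definition sym_tuple (A : finType) (h : seq (word A)) : seq (word A) :=
  flatten [seq [:: w; winv w] | w <- h].

(* The cyclic conjugates of w are the [rot j w] with j < size w; an occurrence
   is the pair (i, j), so that equal words found at distinct positions count as
   distinct occurrences. *)
Definition occurs (A : finType) (h : seq (word A)) (u : word A)
    (o : nat * nat) : bool :=
  let w := nth [::] (sym_tuple h) o.1 in
  [&& (o.1 < size (sym_tuple h))%N, (o.2 < size w)%N & prefix u (rot o.2 w)].

Definition piece (A : finType) (h : seq (word A)) (u : word A) : Prop :=
  exists o1 o2 : nat * nat, [/\ o1 <> o2, occurs h u o1 & occurs h u o2].

Definition small_cancellation (R : realType) (A : finType) (lambda : R)
    (h : seq (word A)) : Prop :=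
  forall (u : word A) (o : nat * nat), piece h u -> occurs h u o ->
    (size u)%:R < lambda * (size (nth [::] (sym_tuple h) o.1))%:R.

(* The law R_n( . | C_n); it is identically 0 when C_n is R_n-null, which by the
   choice of [exp_generic] below counts as a failure. *)
Definition cyc_law (R : realType) (A Q : finType) (M : markov_automaton R A Q)
    (n : nat) (u : n.-tuple (letter A)) : R :=
  (if cyc_reduced u then init_word M u else 0) /
  \sum_(v : n.-tuple (letter A) | cyc_reduced v) init_word M v.

(* Probability that k independent words drawn from [cyc_law M n] satisfy P. *)
Definition tuple_prob (R : realType) (A Q : finType)
    (M : markov_automaton R A Q) (n k : nat) (P : seq (word A) -> Prop) : R :=
  \sum_(h : {ffun 'I_k -> n.-tuple (letter A)} |
          `[< P [seq tval (h i) | i <- enum 'I_k] >])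
     \prod_i cyc_law M (h i).

Definition density_size (R : realType) (alpha d : R) (n : nat) : nat :=
  Num.truncn (alpha `^ (- (d * n%:R))).

(* [s n] is the probability of success. *)
Definition exp_generic (R : realType) (s : nat -> R) : Prop :=
  exists2 c : R, 0 < c &
    (fun n => 1 - s n) =o_\oo (fun n : nat => expR (- (c * n%:R))).

(* Main.v *)
Require Import Defs.
From mathcomp Require Import all_boot all_order all_algebra.
From mathcomp Require Import complex.
From mathcomp Require Import all_classical all_reals all_analysis.
From mathcomp Require Import zify ring lra.

(** Let G(u) be the sum over all states p of gamma(p, u). It is submultiplicative,
    its sum over the words of a given length is #|Q|, and the sum of its squares
    over the words of length m is O(r^m) for every r > alpha, since the entries of
    the powers of M_[2] are. Also alpha < 1, because a state from which some word
    of length #|Q| has probability 1 yields a cycle of probability 1, and the mass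
    of C_n is bounded below, by ergodicity and non-degeneracy.

    If C'(lambda) fails, then either two distinct words of the tuple share, up to
    inversion, a circular factor of length m ~ lambda n, or a single word has, up
    to inversion, two disjoint circular occurrences of a factor of length m/2 (for
    overlapping occurrences with the same orientation, replace the shift by a
    suitable multiple). By 2xy <= x^2 + y^2 such events have probabilities O(r^m)
    and O(r^(m/2)). There are O(k^2 n^2) events of the first kind and O(k n^2) of
    the second, with k = alpha^(-d n), so a union bound concludes for r close
    enough to alpha since d < lambda / 2. *)

Set Implicit Arguments.
Unset Strict Implicit.
Unset Printing Implicit Defensive.

Import Order.TTheory GRing.Theory Num.Theory.
Import numFieldNormedType.Exports.

Local Open Scope ring_scope.

(** * Sums over the words of a given length, and the changes of variable they allow *)

Section WordSum.
Context {R : realType} {A : finType}.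
Implicit Types (n : nat) (u v : word A) (F : word A -> R).

(** The summand takes plain sequences, so that words can be cut, concatenated and rotated without
    casts between tuple types. *)
Definition wsum n F : R := \sum_(u : n.-tuple (letter A)) F u.

Lemma eq_wsum n F1 F2 :
  (forall u, size u = n -> F1 u = F2 u) -> wsum n F1 = wsum n F2.
Proof. by move=> eqF; apply: eq_bigr => u _; rewrite eqF ?size_tuple. Qed.

Lemma ler_wsum n F1 F2 :
  (forall u, size u = n -> F1 u <= F2 u) -> wsum n F1 <= wsum n F2.
Proof. by move=> leF; apply: ler_sum => u _; rewrite leF ?size_tuple. Qed.

Lemma wsum_ge0 n F : (forall u, 0 <= F u) -> 0 <= wsum n F.
Proof. by move=> F_ge0; apply: sumr_ge0. Qed.

Lemma wsumZ n c F : wsum n (fun u => c * F u) = c * wsum n F.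
Proof. by rewrite /wsum mulr_sumr. Qed.

Lemma wsumZr n c F : wsum n (fun u => F u * c) = wsum n F * c.
Proof. by rewrite /wsum mulr_suml. Qed.

Lemma wsumD n F1 F2 : wsum n (fun u => F1 u + F2 u) = wsum n F1 + wsum n F2.
Proof. exact: big_split. Qed.

Lemma wsum_sum (I : finType) n (F : I -> word A -> R) :
  wsum n (fun u => \sum_i F i u) = \sum_i wsum n (F i).
Proof. exact: exchange_big. Qed.

Lemma wsum_exchange m n (F : word A -> word A -> R) :
  wsum m (fun u => wsum n (F u)) = wsum n (fun v => wsum m (F^~ v)).
Proof. exact: exchange_big. Qed.

Lemma wsum0 F : wsum 0 F = F [::].
Proof.
rewrite /wsum (big_pred1 [tuple]) // => u.
by rewrite /= [u]tuple0; apply/esym/eqP.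
Qed.

Lemma wsumS n F : wsum n.+1 F = \sum_a wsum n (fun v => F (a :: v)).
Proof.
rewrite /wsum (pair_big xpredT xpredT (fun a (v : n.-tuple _) => F (a :: v))) /=.
rewrite (reindex (fun p : letter A * n.-tuple (letter A) => [tuple of p.1 :: p.2])) //=.
exists (fun t => (thead t, [tuple of behead t])) => [[a v] _|t _] /=.
  by rewrite theadE; congr pair; apply: val_inj.
by apply: val_inj; rewrite /= -[RHS]/(tval t) {3}(tuple_eta t).
Qed.

Lemma wsum_cat m n F :
  wsum (m + n) F = wsum m (fun u => wsum n (fun v => F (u ++ v))).
Proof.
elim: m F => [|m IHm] F; first by rewrite wsum0.
by rewrite addSn !wsumS; apply: eq_bigr => a _; rewrite IHm.
Qed.

Lemma wsum_rot n i F : wsum n (fun w => F (rot i w)) = wsum n F.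
Proof.
rewrite /wsum [RHS](reindex (fun t : n.-tuple (letter A) => [tuple of rot i t])) //.
exists (fun t : n.-tuple (letter A) => [tuple of rotr i t]) => t _; apply: val_inj => /=.
  exact: rotK.
exact: rotrK.
Qed.

Lemma linvK : involutive (@linv A).
Proof. by case. Qed.

Lemma winvK : involutive (@winv A).
Proof. by move=> u; rewrite /winv map_rev revK mapK //; apply: linvK. Qed.

Lemma size_winv u : size (winv u) = size u.
Proof. by rewrite size_rev size_map. Qed.

Lemma wsum_winv n F : wsum n (fun w => F (winv w)) = wsum n F.
Proof.
pose f (t : n.-tuple (letter A)) := [tuple of rev (map (@linv A) t)].
rewrite /wsum [RHS](reindex f) //; exists f => t _; apply: val_inj; exact: winvK.
Qed.

Lemma wsum_pred1 n F v :
  size v = n -> wsum n (fun u => (u == v)%:R * F u) = F v.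
Proof.
move=> sz_v; have szb : size v == n by rewrite sz_v.
rewrite /wsum (bigD1 (Tuple szb)) //= eqxx mul1r big1 ?addr0 // => t neq_t.
case: eqP => [eq_t|_]; last by rewrite mul0r.
by case/eqP: neq_t; apply: val_inj.
Qed.

End WordSum.

(** * Word probabilities, the submultiplicative weight and its circular variant *)

Section Weight.
Context {R : realType} {A Q : finType} (M : markov_automaton R A Q).
Implicit Types (p q : Q) (u v w : word A) (n c : nat).

Lemma prob_word_ge0 p u : 0 <= prob_word M p u.
Proof.
elim: u p => [|a u IHu] p //=.
by rewrite mulr_ge0 ?prob_ge0 //; case: trans.
Qed.

Lemma prob_word_cat p u v :
  prob_word M p (u ++ v) =
  prob_word M p u * (if run M p u is Some q then prob_word M q v else 0).
Proof.
elim: u p => [|a u IHu] p /=; first by rewrite mul1r.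
by case: trans => [q|]; rewrite ?IHu ?mulrA // !mulr0 ?mul0r.
Qed.

Lemma wsum_prob_word n p : wsum n (prob_word M p) = 1.
Proof.
elim: n p => [|n IHn] p; first by rewrite wsum0.
rewrite wsumS -(prob_sum1 M p); apply: eq_bigr => a _ /=.
rewrite wsumZ; case Ea: trans => [q|]; first by rewrite IHn mulr1.
move/prob_eq0: Ea => ->. by rewrite mul0r.
Qed.

(** This is the function G of the overview. Summing over all starting states dominates the
    probability of a factor wherever it is read. *)
Definition weight u : R := \sum_p prob_word M p u.

Lemma weight_ge0 u : 0 <= weight u.
Proof. by apply: sumr_ge0 => p _; apply: prob_word_ge0. Qed.

Lemma prob_word_le_weight p u : prob_word M p u <= weight u.
Proof.
rewrite /weight (bigD1 p) //= lerDl.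
by apply: sumr_ge0 => q _; apply: prob_word_ge0.
Qed.

Lemma weight_nil : weight [::] = #|Q|%:R.
Proof. by rewrite /weight /= sumr_const. Qed.

(** The state reached after [u] is one of those that [weight v] sums over. *)
Lemma weight_cat_le u v : weight (u ++ v) <= weight u * weight v.
Proof.
rewrite /weight mulr_suml; apply: ler_sum => p _.
rewrite prob_word_cat ler_wpM2l ?prob_word_ge0 //.
case: run => [q|]; first exact: prob_word_le_weight.
exact: weight_ge0.
Qed.

Lemma wsum_weight n : wsum n weight = #|Q|%:R.
Proof.
rewrite /weight wsum_sum (eq_bigr (fun=> 1)) ?sumr_const // => p _.
exact: wsum_prob_word.
Qed.

Lemma init_le1 p : init M p <= 1.
Proof.
rewrite -(init_sum1 M) (bigD1 p) //= lerDl.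
by apply: sumr_ge0 => q _; apply: init_ge0.
Qed.

Lemma init_word_ge0 u : 0 <= init_word M u.
Proof.
by apply: sumr_ge0 => p _; rewrite mulr_ge0 ?init_ge0 ?prob_word_ge0.
Qed.

Lemma init_word_le_weight u : init_word M u <= weight u.
Proof.
apply: ler_sum => p _.
by rewrite ler_piMl ?prob_word_ge0 ?init_le1.
Qed.

(* If [w] is cut at position [i] into [x ++ y], the factors of [rot i w] that
   wrap around the cut have their weight controlled by
   [cweight (size y) (y ++ x) = weight y * weight x >= weight w]. *)
Definition cweight c u : R := weight (take c u) * weight (drop c u).

Lemma cweight_ge0 c u : 0 <= cweight c u.
Proof. by rewrite mulr_ge0 ?weight_ge0. Qed.

Lemma weight_le_cweight_rot i u :
  weight u <= cweight (size u - i) (rot i u).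
Proof.
rewrite /cweight /rot -size_drop take_size_cat // drop_size_cat // mulrC.
by rewrite -{1}(cat_take_drop i u) weight_cat_le.
Qed.

Hypothesis Q_gt0 : (0 < #|Q|)%N.

Let Q_ge1 : 1 <= #|Q|%:R :> R. Proof. by rewrite ler1n. Qed.

(** The cut falls in only one of [u] and [v]. The other one is then cut at an end, which brings in a
    factor [weight [::] = #|Q|], harmless because it is at least 1. Truncated subtraction places the
    cut of [v] at 0 when it lies in [u]. *)
Lemma cweight_cat_le c u v :
  cweight c (u ++ v) <= cweight c u * cweight (c - size u) v.
Proof.
rewrite /cweight take_cat drop_cat; case: ltnP => [lt_cu|le_uc].
  have /eqP-> : (c - size u == 0)%N by rewrite subn_eq0 ltnW.
  rewrite take0 drop0 weight_nil -mulrA ler_wpM2l ?weight_ge0 //.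
  apply: le_trans (weight_cat_le _ _) _; rewrite ler_wpM2l ?weight_ge0 //.
  by rewrite ler_peMl ?weight_ge0.
rewrite (take_oversize le_uc) (drop_oversize le_uc) weight_nil.
apply: (@le_trans _ _ ((weight u * weight (take (c - size u) v)) *
    weight (drop (c - size u) v))).
  by rewrite ler_wpM2r ?weight_ge0 ?weight_cat_le.
rewrite -mulrA -[leRHS]mulrA ler_wpM2l ?weight_ge0 //.
by rewrite ler_peMl // mulr_ge0 ?weight_ge0.
Qed.

Lemma wsum_take_drop n c (f g : word A -> R) :
  wsum n (fun u => f (take c u) * g (drop c u)) =
  wsum (minn c n) f * wsum (n - c) g.
Proof.
have [le_cn|lt_nc] := leqP c n.
  rewrite -{1}(subnKC le_cn) wsum_cat -wsumZr; apply: eq_wsum => u sz_u.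
  rewrite -wsumZ; apply: eq_wsum => v _.
  by rewrite take_size_cat // drop_size_cat.
have /eqP-> : (n - c == 0)%N by rewrite subn_eq0 ltnW.
rewrite wsum0 -wsumZr; apply: eq_wsum => u sz_u.
by rewrite take_oversize ?drop_oversize ?sz_u // ltnW.
Qed.

Lemma wsum_cweight n c : wsum n (cweight c) = #|Q|%:R ^+ 2.
Proof. by rewrite wsum_take_drop !wsum_weight. Qed.

End Weight.

(** * Growth of the powers of a matrix in terms of its spectral radius *)

Section MatrixPowerBound.
Local Open Scope complex_scope.

(** The constant K' on the right satisfies [|z| * K' + K <= r * K'], which is what the induction
    needs. *)
Lemma affine_recurrence_bound (F : numFieldType) (a b : nat -> F) (z r K : F) :
    `|z| < r -> 0 <= K -> (forall m, a m.+1 = z * a m + b m) ->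
    (forall m, `|b m| <= K * r ^+ m) ->
  forall m, `|a m| <= (`|a 0%N| + K / (r - `|z|)) * r ^+ m.
Proof.
move=> lt_zr K_ge0 aS b_le; have rz_gt0 : 0 < r - `|z| by rewrite subr_gt0.
set K' := `|a 0%N| + _.
have K'_ge0 : 0 <= K' by rewrite /K' addr_ge0 // divr_ge0 // ltW.
have r_ge0 : 0 <= r by rewrite (le_trans _ (ltW lt_zr)).
elim=> [|m IHm]; first by rewrite mulr1 lerDl divr_ge0 // ltW.
rewrite aS (le_trans (ler_normD _ _)) // normrM.
apply: (@le_trans _ _ (`|z| * (K' * r ^+ m) + K * r ^+ m)).
  by rewrite lerD // ler_wpM2l.
rewrite mulrA -mulrDl exprS mulrA ler_wpM2r ?exprn_ge0 //.
rewrite -lerBrDl [K' * r]mulrC -mulrBl /K' mulrDr mulrCA divff ?gt_eqF // mulr1.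
by rewrite lerDr mulr_ge0 // ltW.
Qed.

(** This avoids Jordan forms by peeling off one linear factor at a time. The entries of [B ^+ m * D]
    satisfy an affine recurrence of ratio [z], whose inhomogeneous term is the same expression for
    [(B - z%:M) * D]. The matrix [D] is there to make this induction possible. *)
Lemma mx_pow_bound_of_annihilator (F : numFieldType) n (B D : 'M[F]_n.+1)
    (s : seq F) (r : F) :
    0 < r -> {in s, forall z, `|z| < r} ->
    \prod_(z <- s) (B - z%:M) * D = 0 ->
  exists2 K, 0 <= K & forall m i j, `|(B ^+ m * D) i j| <= K * r ^+ m.
Proof.
move=> r_gt0; elim/last_ind: s D => [|s z IHs] D lt_sr.
  rewrite big_nil mul1r => ->; exists 0 => // m i j.
  by rewrite mulr0 mxE normr0 mul0r.
rewrite -cats1 big_cat big_seq1 -mulrA => /IHs[|K K_ge0 leK].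
  by move=> y s_y; rewrite lt_sr // mem_rcons inE s_y orbT.
have lt_zr : `|z| < r by rewrite lt_sr // mem_rcons inE eqxx.
have rz_gt0 : 0 < r - `|z| by rewrite subr_gt0.
exists (\sum_i \sum_j `|D i j| + K / (r - `|z|)).
  apply: addr_ge0; last by rewrite divr_ge0 // ltW.
  by apply: sumr_ge0 => i _; apply: sumr_ge0.
move=> m i j.
pose a m := (B ^+ m * D) i j; pose b m := (B ^+ m * ((B - z%:M) * D)) i j.
have aS k : a k.+1 = z * a k + b k.
  rewrite /a /b mulrBl mulrBr mulrA -exprSr; set X := B ^+ k.+1 * D.
  have -> : B ^+ k * (z%:M * D) = z *: (B ^+ k * D).
    by rewrite -[z%:M * D]/(z%:M *m D) mul_scalar_mx -[LHS]/(_ *m _) -scalemxAr.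
  by rewrite !mxE addrCA subrr addr0.
apply: (le_trans (affine_recurrence_bound lt_zr K_ge0 aS (fun k => leK k i j) m)).
rewrite ler_wpM2r ?exprn_ge0 ?(ltW r_gt0) // lerD2r /a expr0 mul1r.
rewrite (bigD1 i) //= (bigD1 j) //= -addrA lerDl.
by rewrite addr_ge0 ?sumr_ge0 // => ? _; rewrite sumr_ge0.
Qed.

Context {R : realType}.

Lemma normc_Re (z : R[i]) : (complex.Re `|z|)%:C = `|z|.
Proof. by rewrite RRe_real // ger0_real. Qed.

Lemma eigenvalue_le_spectral_radius n (B : 'M[R]_n) z :
  eigenvalue (map_mx (real_complex R) B) z ->
  complex.Re `|z| <= spectral_radius B.
Proof.
set BC := map_mx _ B => eig_z; apply: ub_le_sup; last by exists z.
have [s Ds] := closed_field_poly_normal (char_poly BC).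
(* The supremum is an upper bound only once the set is known to be bounded. Eigenvalues are roots of
   the characteristic polynomial, so the sum of the moduli of all roots bounds it. *)
exists (\sum_(y <- s) complex.Re `|y|) => _ [y eig_y <-].
have Re_ge0 (x : R[i]) : 0 <= complex.Re `|x| by rewrite -ler0c normc_Re.
have s_y : y \in s.
  move: eig_y => /=; rewrite eigenvalue_root_char Ds.
  by rewrite (monicP (char_poly_monic _)) scale1r root_prod_XsubC.
by rewrite (big_rem y) //= lerDl sumr_ge0 // => t _; apply: Re_ge0.
Qed.

(** Over the complex numbers, Cayley-Hamilton provides an annihilating product of linear factors
    whose roots are the eigenvalues. *)
Lemma mx_pow_bound n (B : 'M[R]_n) (r : R) :
    0 < r -> spectral_radius B < r ->
  exists2 K, 0 <= K & forall m i j, `|(B ^+ m) i j| <= K * r ^+ m.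
Proof.
case: n B => [|n] B r_gt0 lt_Br.
  by exists 0 => // m [].
set BC := map_mx (real_complex R) B.
have [s Ds] := closed_field_poly_normal (char_poly BC).
have s_lt : {in s, forall z, `|z| < r%:C}.
  move=> z s_z; rewrite -normc_Re ltcR; apply: le_lt_trans lt_Br.
  apply: eigenvalue_le_spectral_radius; rewrite eigenvalue_root_char Ds.
  rewrite rootZ ?root_prod_XsubC // lead_coef_eq0 -size_poly_eq0.
  by rewrite size_char_poly.
have ann : \prod_(z <- s) (BC - z%:M) * 1 = 0.
  rewrite mulr1 -(Cayley_Hamilton BC) Ds.
  rewrite (monicP (char_poly_monic _)) scale1r rmorph_prod /=.
  by apply: eq_bigr => z _; rewrite rmorphB /= horner_mx_X horner_mx_C.
have [|K K_ge0 leK] := mx_pow_bound_of_annihilator _ s_lt ann.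
  by rewrite ltcR.
exists (complex.Re K) => [|m i j].
  by rewrite -lecR RRe_real // ger0_real.
have := leK m i j; rewrite mulr1 -(rmorphXn (map_mx (real_complex R))) mxE.
rewrite -lecR rmorphM rmorphXn /= RRe_real ?ger0_real // normc_def /=.
by rewrite expr0n /= addr0 sqrtr_sqr.
Qed.

End MatrixPowerBound.

(** * A row-sum criterion for a spectral radius below 1 *)

Section SpectralRadiusLt1.
Local Open Scope complex_scope.
Context {R : realType}.

(** For a left eigenvector [v] of eigenvalue [z], comparing the sums of moduli of [v] and
    [v *m B ^+ m] gives [|z| ^+ m <= rho], where [rho] is the largest row sum. The resulting bound,
    the [m]-th root of [rho], is uniform in [z], so it passes to the supremum. *)
Lemma spectral_radius_lt1 n (B : 'M[R]_n) m :
    (0 < m)%N -> (forall i j, 0 <= (B ^+ m) i j) ->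
    (forall i, \sum_j (B ^+ m) i j < 1) ->
  spectral_radius B < 1.
Proof.
move=> m_gt0 Bm_ge0 row_lt1.
pose rho := \big[Num.max/0]_i \sum_j (B ^+ m) i j.
have rho_ge0 : 0 <= rho by apply: bigmax_ge_id.
have rho_lt1 : rho < 1 by apply: bigmax_lt.
have row_le i : \sum_j (B ^+ m) i j <= rho by apply: le_bigmax.
pose s := rho `^ m%:R^-1.
have sX : s ^+ m = rho.
  by rewrite -powR_mulrn ?powR_ge0 // -powRrM mulVf ?pnatr_eq0 -?lt0n // powRr1.
have s_lt1 : s < 1.
  by rewrite ltNge; apply: contraL rho_lt1 => s_ge1; rewrite -leNgt -sX exprn_ege1.
apply: le_lt_trans s_lt1; rewrite /spectral_radius.
set E := (X in sup X); have [->|/set0P E_nz] := eqVneq E set0.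
  by rewrite sup0 powR_ge0.
apply: ge_sup => // _ [z /eigenvalueP[v v_eig v_nz] <-].
rewrite leNgt; apply/negP => lt_sz.
pose S : R[i] := \sum_j `|v ord0 j|.
have S_gt0 : 0 < S.
  rewrite lt0r sumr_ge0 // andbT psumr_neq0 //.
  have /rV0Pn[j vj_nz] := v_nz.
  by apply/hasP; exists j; rewrite ?mem_index_enum // normr_gt0.
have v_eigX k : v *m map_mx (real_complex R) (B ^+ k) = z ^+ k *: v.
  elim: k => [|k IHk]; first by rewrite !expr0 map_mx1 mulmx1 scale1r.
  by rewrite exprSr map_mxM mulmxA IHk -scalemxAl v_eig scalerA -exprSr.
have : `|z| ^+ m * S <= rho%:C * S.
  have -> : `|z| ^+ m * S = \sum_j `|(z ^+ m *: v) ord0 j|.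
    rewrite mulr_sumr; apply: eq_bigr => j _.
    by rewrite !mxE normrM normrX.
  rewrite -v_eigX.
  apply: (@le_trans _ _ (\sum_j \sum_i `|v ord0 i| * ((B ^+ m) i j)%:C)).
    apply: ler_sum => j _; rewrite !mxE.
    apply: le_trans (ler_norm_sum _ _ _) _; apply: ler_sum => i _.
    by rewrite normrM !mxE [`|_%:C|]ger0_norm ?ler0c.
  rewrite exchange_big mulr_sumr; apply: ler_sum => i _ /=.
  by rewrite -mulr_sumr mulrC ler_wpM2r // -rmorph_sum lecR.
rewrite ler_pM2r // -normc_Re -rmorphXn lecR -sX leNgt => /negP[].
by rewrite ltrXn2r ?powR_ge0 // -lt0n.
Qed.

End SpectralRadiusLt1.

(** * The coincidence probability is below 1 and controls the sums of squared weights *)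

Section CoincidenceLt1.
Context {R : realType} {A Q : finType} (M : markov_automaton R A Q).
Implicit Types (p q : Q) (u v w : word A).

(** An extended state remembers the last letter read, so a path of extended states from [x] amounts
    to a word. Squaring entries therefore squares the probability of each word separately, even when
    several letters join the same two states. *)
Lemma ext_mx2_expr_row_sum m (x : ext_state M) :
  \sum_j (ext_mx2 M ^+ m) (enum_rank x) j =
  wsum m (fun u => prob_word M (val x).1 u ^+ 2).
Proof.
elim: m x => [|m IHm] x.
  rewrite wsum0 expr1n (bigD1 (enum_rank x)) //= big1 ?addr0 ?expr0.
    by rewrite mxE eqxx.
  by move=> j /negPf neq_j; rewrite mxE eq_sym neq_j.
rewrite wsumS exprS.
transitivity (\sum_(y : ext_state M) ext_prob x y ^+ 2 *
    wsum m (fun u => prob_word M (val y).1 u ^+ 2)).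
  under eq_bigr do rewrite mxE.
  rewrite exchange_big (reindex (@enum_rank _)) /=; last first.
    exact/onW_bij/enum_rank_bij.
  apply: eq_bigr => y _; rewrite -IHm mulr_sumr; apply: eq_bigr => j _.
  by rewrite mxE !enum_rankK.
(* Successors are grouped by their letter [a]; at most one of each group is reachable from [x],
   namely [y0]. *)
rewrite (partition_big (fun y : ext_state M => (val y).2) xpredT) //=.
apply: eq_bigr => a _; under [RHS]eq_wsum do rewrite exprMn.
rewrite wsumZ; case Ea: (trans M (val x).1 a) => [q|]; last first.
  rewrite [prob _ _ _](prob_eq0 M _ _).2 // expr0n mul0r big1 // => y /eqP Dy.
  by rewrite /ext_prob Dy Ea expr0n mul0r.
have y0P : [exists p, trans M p (q, a).2 == Some (q, a).1].
  by apply/existsP; exists (val x).1; apply/eqP.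
pose y0 : ext_state M := exist _ (q, a) y0P.
rewrite (bigD1 y0) //= big1 ?addr0 => [|y /andP[/eqP Dy neq_y]].
  by rewrite /ext_prob /= Ea eqxx.
rewrite /ext_prob Dy Ea; case: eqP => [[Dq]|_]; last by rewrite expr0n mul0r.
case/eqP: neq_y; apply: val_inj => /=.
by rewrite [val y]surjective_pairing Dy Dq.
Qed.

Lemma ext_mx2_expr_ge0 m i j : 0 <= (ext_mx2 M ^+ m) i j.
Proof.
elim: m i j => [|m IHm] i j; first by rewrite expr0 mxE; case: eqP.
by rewrite exprS mxE sumr_ge0 // => k _; rewrite mulr_ge0 // mxE sqr_ge0.
Qed.

Lemma prob_word_le1 p u : prob_word M p u <= 1.
Proof.
rewrite -(wsum_prob_word M (size u) p) /wsum (bigD1 (in_tuple u)) //= lerDl.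
by rewrite sumr_ge0 // => v _; apply: prob_word_ge0.
Qed.

Lemma prob_word_cat1 p u v :
  prob_word M p (u ++ v) = 1 ->
  prob_word M p u = 1 /\ exists2 q, run M p u = Some q & prob_word M q v = 1.
Proof.
rewrite prob_word_cat => uv1.
have u1 : prob_word M p u = 1.
  apply/eqP; rewrite eq_le prob_word_le1 /= -uv1.
  rewrite ler_piMr ?prob_word_ge0 //.
  by case: run => [q|]; rewrite ?prob_word_le1.
split=> //; move: uv1; rewrite u1 mul1r; case: run => [q v1|/eqP].
  by exists q.
by rewrite eq_sym oner_eq0.
Qed.

Lemma run_cat p u v :
  run M p (u ++ v) = if run M p u is Some q then run M q v else None.
Proof. by elim: u p => [|a u IHu] p //=; case: trans. Qed.

(** Pigeonhole: reading [u] visits [#|Q| + 1] states, and the factor read between two visits to the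
    same state would be a cycle of probability 1. *)
Lemma prob_word_lt1 p u :
  ~ has_prob1_cycle M -> size u = #|Q| -> prob_word M p u < 1.
Proof.
move=> no_cycle sz_u; rewrite lt_neqAle prob_word_le1 andbT.
apply/eqP => u1; apply: no_cycle.
(* The default [p] is never taken, as every prefix of a word of probability 1 has a defined run. *)
pose f (i : 'I_#|Q|.+1) := odflt p (run M p (take i u)).
have /injectivePn[i [j neq_ij eq_f]] : ~~ injectiveb f.
  by apply/injectiveP => /leq_card; rewrite card_ord ltnn.
wlog lt_ij : i j neq_ij eq_f / (i < j)%N.
  move=> IH; case: (ltngtP i j) => [|lt_ji|/ord_inj eq_ij].
  - exact: IH.
  - by apply: (IH j i); rewrite 1?eq_sym.
  - by rewrite eq_ij eqxx in neq_ij.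
have Dj : take j u = take i u ++ drop i (take j u).
  by rewrite -[take i u](take_takel u (ltnW lt_ij)) cat_take_drop.
have Du : u = take i u ++ drop i (take j u) ++ drop j u.
  by rewrite catA -Dj cat_take_drop.
move: eq_f; rewrite /f Dj.
move: u1; rewrite {1}Du => /prob_word_cat1[_ [q Dq /prob_word_cat1[v1 [q' Dq' _]]]].
rewrite run_cat Dq Dq' /= => eq_q; exists q, (drop i (take j u)); split=> //.
  have lt_ju : (j <= size u)%N by rewrite sz_u -ltnS.
  by rewrite -size_eq0 size_drop size_takel // subn_eq0 -ltnNge.
by rewrite Dq' eq_q.
Qed.

(** The row sums of the power [#|Q|] are sums of squares of numbers in [0, 1] of total 1. Some of
    these numbers is positive, and it is below 1 in the absence of cycles of probability 1, so the
    sum of squares is strictly smaller than 1. *)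
Lemma coincidence_lt1 :
  (0 < #|Q|)%N -> ~ has_prob1_cycle M -> coincidence M < 1.
Proof.
move=> Q_gt0 no_cycle.
apply: (spectral_radius_lt1 Q_gt0) => [|i]; first exact: ext_mx2_expr_ge0.
rewrite -(enum_valK i) ext_mx2_expr_row_sum; set p := (val _).1.
rewrite -(wsum_prob_word M #|Q| p) -subr_gt0 /wsum -sumrB lt0r.
have term_ge0 (u : #|Q|.-tuple (letter A)) :
    0 <= prob_word M p u - prob_word M p u ^+ 2.
  by rewrite subr_ge0 expr2 ler_piMr ?prob_word_ge0 ?prob_word_le1.
rewrite sumr_ge0 ?andbT // psumr_eq0 //; apply/allPn.
have : \sum_(u : #|Q|.-tuple (letter A)) prob_word M p u != 0.
  by rewrite [X in X != 0]wsum_prob_word oner_eq0.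
rewrite psumr_neq0 => [/hasP[u _ /= u_gt0]|u _]; last exact: prob_word_ge0.
exists u; rewrite ?mem_index_enum //= gt_eqF //.
by rewrite subr_gt0 expr2 gtr_pMr // prob_word_lt1 ?size_tuple.
Qed.

(** The Cauchy-Schwarz inequality against a constant vector. *)
Lemma sqr_sum_le (I : finType) (x : I -> R) :
  (\sum_i x i) ^+ 2 <= #|I|%:R * \sum_i x i ^+ 2.
Proof.
have sumE : \sum_i \sum_(j : I) x i ^+ 2 = #|I|%:R * \sum_i x i ^+ 2.
  by rewrite mulr_sumr; apply: eq_bigr => i _; rewrite sumr_const mulr_natl.
rewrite -(ler_pM2l (ltr0n R 2)).
have -> : 2%:R * (#|I|%:R * \sum_i x i ^+ 2) =
    \sum_i \sum_j (x i ^+ 2 + x j ^+ 2).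
  under [RHS]eq_bigr do rewrite big_split /=.
  by rewrite big_split /= [X in _ = _ + X]exchange_big /= sumE mulr_natl mulr2n.
rewrite expr2 mulr_suml mulr_sumr; apply: ler_sum => i _; rewrite !mulr_sumr.
by apply: ler_sum => j _; have := sqr_ge0 (x i - x j); nra.
Qed.

(** Cauchy-Schwarz separates the starting states [p], and an edge into [p] provides an extended
    state over [p], hence a row of the matrix. *)
Lemma weight_sqr_bound (r : R) :
    (forall q, exists p, edge M p q) -> 0 < r -> coincidence M < r ->
  exists2 C, 0 <= C & forall m, wsum m (fun u => weight M u ^+ 2) <= C * r ^+ m.
Proof.
move=> edge_to r_gt0 lt_r; have [K K_ge0 leK] := mx_pow_bound r_gt0 lt_r.
pose C := #|Q|%:R * (#|Q|%:R * (#|ext_state M|%:R * K)).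
exists C; first by rewrite !mulr_ge0.
move=> m; apply: (@le_trans _ _ (wsum m (fun u => #|Q|%:R * \sum_p prob_word M p u ^+ 2))).
  by apply: ler_wsum => u _; apply: sqr_sum_le.
rewrite wsumZ wsum_sum /C -mulrA ler_wpM2l // -mulrA mulr_natl -sumr_const.
apply: ler_sum => p _; have [q /existsP[a /eqP q_a]] := edge_to p.
have xP : [exists q, trans M q (p, a).2 == Some (p, a).1].
  by apply/existsP; exists q; apply/eqP.
pose x : ext_state M := exist _ (p, a) xP.
rewrite -[p]/((val x).1) -ext_mx2_expr_row_sum -mulrA mulr_natl.
rewrite -[X in _ *+ X]card_ord -sumr_const; apply: ler_sum => j _.
by apply: le_trans (leK m _ j); apply: ler_norm.
Qed.

End CoincidenceLt1.

(** * A lower bound for the mass of the cyclically reduced words *)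

Section CycReducedMass.
Context {R : realType} {A Q : finType} (M : markov_automaton R A Q).
Implicit Types (p q : Q) (u v w : word A).

Local Notation T := (trans_mx M).

Lemma sum_trans_pred (p : Q) (F : letter A -> Q -> R) :
  \sum_q \sum_(a | trans M p a == Some q) prob M p a * F a q =
  \sum_a prob M p a * (if trans M p a is Some q then F a q else 0).
Proof.
rewrite (exchange_big_dep xpredT) //=; apply: eq_bigr => a _.
case: (trans M p a) => [q|]; last by rewrite big_pred0 ?mulr0.
by rewrite (big_pred1 q) // => q'; rewrite /= eq_sym.
Qed.

Lemma trans_mx_ge0 i j : 0 <= T i j.
Proof. by rewrite mxE sumr_ge0 // => a _; apply: prob_ge0. Qed.

Lemma trans_mx_expr_ge0 n i j : 0 <= (T ^+ n) i j.
Proof.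
elim: n i j => [|n IHn] i j; first by rewrite expr0 mxE; case: eqP.
by rewrite exprS mxE sumr_ge0 // => k _; rewrite mulr_ge0 ?trans_mx_ge0.
Qed.

Lemma trans_mx_expr_mul_le m n i k j :
  (T ^+ m) i k * (T ^+ n) k j <= (T ^+ (m + n)) i j.
Proof.
rewrite exprD [leRHS]mxE (bigD1 k) //= lerDl sumr_ge0 // => l _.
by rewrite mulr_ge0 ?trans_mx_expr_ge0.
Qed.

Lemma trans_mx_exprE n p q :
  (T ^+ n) (enum_rank p) (enum_rank q) =
  wsum n (fun u => (run M p u == Some q)%:R * prob_word M p u).
Proof.
elim: n p => [|n IHn] p.
  rewrite wsum0 mulr1 expr0 mxE /= (inj_eq enum_rank_inj).
  by rewrite -[Some p == Some q]/(p == q).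
rewrite wsumS exprS mxE (reindex (@enum_rank _)) /=; last first.
  exact/onW_bij/enum_rank_bij.
under eq_bigr do rewrite mxE !enum_rankK /trans_prob mulr_suml IHn.
rewrite (sum_trans_pred p (fun _ q' => wsum n _)); apply: eq_bigr => a _.
rewrite /=; case: (trans M p a) => [q'|].
  by rewrite -wsumZ; apply: eq_wsum => u _; rewrite mulrCA.
by rewrite mulr0 /wsum big1 // => u _; rewrite !mulr0.
Qed.

Lemma trans_mx_expr_row_sum n i : \sum_j (T ^+ n) i j = 1.
Proof.
rewrite -(enum_valK i) (reindex (@enum_rank _)) /=; last first.
  exact/onW_bij/enum_rank_bij.
rewrite -(wsum_prob_word M n (enum_val i)).
under eq_bigr do rewrite trans_mx_exprE.
rewrite -wsum_sum; apply: eq_wsum => u _; rewrite -mulr_suml.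
have [/existsP[q /eqP->]|] := boolP [exists q, run M (enum_val i) u == Some q].
  rewrite (bigD1 q) //= eqxx big1 ?addr0 ?mul1r //.
  by move=> q' /negPf neq; rewrite -[Some _ == _]/(q == q') eq_sym neq.
move=> no_run; suff -> : prob_word M (enum_val i) u = 0 by rewrite mulr0.
move: no_run; elim: u (enum_val i) => [|a u IHu] p /=.
  by case/existsP; exists p.
case Ea: (trans M p a) => [q|] no_run; last by rewrite mulr0.
by rewrite IHu ?mulr0.
Qed.

Lemma edgeP p q : edge M p q -> 0 < T (enum_rank p) (enum_rank q).
Proof.
case/existsP=> a Ea; rewrite mxE !enum_rankK /trans_prob (bigD1 a) //=.
rewrite ltr_wpDr ?sumr_ge0 // => [b _|]; first exact: prob_ge0.
rewrite lt0r prob_ge0 andbT; apply/eqP => /prob_eq0.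
by move/eqP: Ea => ->.
Qed.

Lemma trans_mx_expr_path_gt0 p s :
  path (edge M) p s -> 0 < (T ^+ size s) (enum_rank p) (enum_rank (last p s)).
Proof.
elim: s p => [|q s IHs] p /=; first by rewrite expr0 mxE eqxx.
case/andP=> /edgeP pq /IHs qs; rewrite -add1n.
by apply: lt_le_trans (trans_mx_expr_mul_le _ _ _ (enum_rank q) _); rewrite mulr_gt0.
Qed.

Hypothesis M_ergodic : ergodic M.

(** The last step of a return to [q] of positive probability enters [q]. *)
Lemma ergodic_edge_to q : exists p, edge M p q.
Proof.
have [_ [N _ posN]] := M_ergodic.
have := posN N.+1 (leqnSn N) (enum_rank q); rewrite exprSr mxE => /gt_eqF/negbT.
rewrite psumr_neq0 => [|k _]; last by rewrite mulr_ge0 ?trans_mx_expr_ge0 ?trans_mx_ge0.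
case/hasP=> k _ /= /gt_eqF; rewrite mulf_eq0 => /norP[_].
rewrite mxE enum_rankK psumr_neq0 => [/hasP[a _ /andP[Ea _]]|a _].
  by exists (enum_val k); apply/existsP; exists a.
exact: prob_ge0.
Qed.

(** One power [N] has only positive entries: a simple path from [p] to [q] has length at most
    [#|Q|], and a return to [q] fills the remaining length, which is at least [N0]. For [n >= N],
    the entries of [T ^+ n] are averages of entries of [T ^+ N], because the rows of [T ^+ (n - N)]
    sum to 1. *)
Lemma trans_mx_expr_lb :
  exists2 delta, 0 < delta &
    exists N, forall n i j, (N <= n)%N -> delta <= (T ^+ n) i j.
Proof.
have [conn [N0 _ posN]] := M_ergodic.
pose N := (N0 + #|Q|)%N.
have TN_gt0 i j : 0 < (T ^+ N) i j.
  rewrite -(enum_valK i) -(enum_valK j); set p := enum_val i; set q := enum_val j.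
  have /connectP[s0 path_s0 ->] := conn p q.
  case/shortenP: path_s0 => s path_s uniq_s _.
  have sz_s : (size s <= #|Q|)%N.
    by apply: ltnW; rewrite -[(size s).+1]/(size (p :: s)) -(card_uniqP uniq_s) max_card.
  rewrite -(subnKC (leq_trans sz_s (leq_addl N0 _) : (size s <= N)%N)).
  apply: lt_le_trans (trans_mx_expr_mul_le _ _ _ (enum_rank (last p s)) _).
  rewrite mulr_gt0 ?trans_mx_expr_path_gt0 //; apply: posN => /=.
  by rewrite -addnBA // leq_addr.
pose delta := \big[Num.min/1]_i \big[Num.min/1]_j (T ^+ N) i j.
exists delta; first by do 2![apply: lt_bigmin => // ? _].
exists N => n i j le_Nn; rewrite -(subnK le_Nn) exprD mxE.
rewrite -[leLHS]mul1r -(trans_mx_expr_row_sum (n - N) i) mulr_suml.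
apply: ler_sum => k _; rewrite ler_wpM2l ?trans_mx_expr_ge0 //.
by apply: (@bigmin_inf _ _ _ _ k) => //; apply: (@bigmin_inf _ _ _ _ j).
Qed.

(** Otherwise every possible first letter [a] would force the stationary letter law to be
    concentrated on [linv a], and the sum in [non_degenerate] would be the sum of the initial letter
    law, which is 1. *)
Lemma non_degenerate_letters (g : 'rV[R]_#|Q|) :
    stationary M g -> non_degenerate M g ->
  exists p q a b, [/\ 0 < init M p, 0 < prob M p a, 0 < prob M q b & b != linv a].
Proof.
move=> [g_ge0 g_sum1 _] nondeg; apply/not_existsP => no_letters.
have stat_ge0 b : 0 <= stat_letter M g b.
  by rewrite sumr_ge0 // => q _; rewrite mulr_ge0 ?prob_ge0.
have stat_sum1 : \sum_b stat_letter M g b = 1.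
  rewrite exchange_big /= -g_sum1 (reindex (@enum_rank _)) /=; last first.
    exact/onW_bij/enum_rank_bij.
  by apply: eq_bigr => q _; rewrite -mulr_sumr prob_sum1 mulr1.
have init_sum1 : \sum_a init_letter M a = 1.
  rewrite exchange_big /= -(init_sum1 M); apply: eq_bigr => p _.
  by rewrite -mulr_sumr prob_sum1 mulr1.
case/eqP: nondeg; rewrite -init_sum1; apply: eq_bigr => a _.
have [-> | init_a] := eqVneq (init_letter M a) 0; first by rewrite mul0r.
rewrite -[RHS]mulr1; congr (_ * _); rewrite -stat_sum1 (bigD1 (linv a)) //=.
rewrite big1 ?addr0 // => b neq_b; apply/eqP; apply: contraNT init_a => stat_b.
rewrite /init_letter big1 // => p _; apply/eqP; apply: contraNT stat_b => init_pa.
rewrite /stat_letter big1 // => q _; apply/eqP; apply/negPn/negP => stat_qb.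
case: (no_letters p); exists q, a, b.
move: init_pa stat_qb; rewrite !mulf_eq0 !negb_or => /andP[ip pa] /andP[_ qb].
by split; rewrite // lt0r ?ip ?pa ?qb ?init_ge0 ?prob_ge0.
Qed.

(** It is enough to count the words [a :: u ++ [:: b]] in which [u] leads to the state [q] from
    which [b] is read. Those of positive probability are reduced by the support hypothesis, and
    cyclically so as [b != linv a]. *)
Lemma cyc_reduced_mass_lb (g : 'rV[R]_#|Q|) :
    stationary M g -> non_degenerate M g -> reduced_support M ->
  exists2 c, 0 < c & exists N, forall n, (N <= n)%N ->
    c <= \sum_(v : n.-tuple (letter A) | cyc_reduced v) init_word M v.
Proof.
move=> g_stat g_nondeg M_supp.
have [p [q [a [b [ip pa qb neq_b]]]]] := non_degenerate_letters g_stat g_nondeg.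
have [p' Dp'] : exists p', trans M p a = Some p'.
  case Ea: (trans M p a) => [p'|]; first by exists p'.
  by move/prob_eq0: Ea pa => ->; rewrite ltxx.
have [delta delta_gt0 [N TN]] := trans_mx_expr_lb.
exists (init M p * prob M p a * delta * prob M q b); first by rewrite !mulr_gt0.
exists N.+2 => -[|[|n]] // le_Nn.
rewrite big_mkcond -[leRHS]/(wsum n.+2 (fun v => if cyc_reduced v then init_word M v else 0)).
rewrite wsumS (bigD1 a) //= ler_wpDr ?sumr_ge0 // => [c _|].
  by apply: wsum_ge0 => u; case: ifP => // _; apply: init_word_ge0.
rewrite -[n.+1]addn1 wsum_cat.
apply: (@le_trans _ _ (wsum n (fun u => init M p * prob M p a *
    ((run M p' u == Some q)%:R * prob_word M p' u) * prob M q b))).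
  rewrite wsumZr wsumZ -trans_mx_exprE ler_wpM2r ?(ltW qb) //.
  by rewrite ler_wpM2l ?mulr_ge0 ?(ltW ip) ?(ltW pa) // TN.
apply: ler_wsum => u _; rewrite wsumS (bigD1 b) //=.
rewrite ler_wpDr ?sumr_ge0 // => [c _|].
  by apply: wsum_ge0 => v; case: ifP => // _; apply: init_word_ge0.
rewrite wsum0; set w := a :: u ++ [:: b].
have Dw : init M p * prob M p a * ((run M p' u == Some q)%:R * prob_word M p' u)
    * prob M q b <= init M p * prob_word M p w.
  rewrite /w /= Dp' prob_word_cat -!mulrA ler_wpM2l ?init_ge0 //.
  rewrite ler_wpM2l ?prob_ge0 // mulrCA ler_wpM2l ?prob_word_ge0 //.
  case: eqP => [->|_] /=; last first.
    rewrite mul0r; case: run => // q'; rewrite mulr_ge0 ?prob_ge0 //.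
    by case: trans.
  rewrite mul1r; case Eb: (trans M q b) => [q'|]; first by rewrite mulr1.
  by move/prob_eq0: Eb => ->; rewrite mul0r.
apply: (le_trans Dw).
have le_init : init M p * prob_word M p w <= init_word M w.
  rewrite /init_word (bigD1 p) // lerDl; apply: sumr_ge0 => p1 _.
  apply: mulr_ge0; [exact: init_ge0 | exact: prob_word_ge0].
rewrite last_cat /= neq_b andbT.
case: ifPn => // /negP not_reduced; rewrite leNgt; apply/negP => w_gt0.
apply: not_reduced.
by apply: M_supp; rewrite gt_eqF // (lt_le_trans w_gt0).
Qed.

End CycReducedMass.

(** * Weighted sums over words with a repeated circular factor *)

Section Coincidences.
Context {R : realType} {A Q : finType} (M : markov_automaton R A Q).
Implicit Types (u v w : word A) (n m i j : nat) (F : word A -> R).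

Hypothesis Q_gt0 : (0 < #|Q|)%N.

(** The boolean lets direct and inverse repetitions be treated together. *)
Definition orient (e : bool) u : word A := if e then winv u else u.

Lemma orientK e : involutive (orient e).
Proof. by case: e => u //=; apply: winvK. Qed.

Lemma size_orient e u : size (orient e u) = size u.
Proof. by case: e; rewrite ?size_winv. Qed.

Lemma wsum_orient e n F : wsum n (fun u => F (orient e u)) = wsum n F.
Proof. by case: e => //; apply: wsum_winv. Qed.

Lemma wsum_pred1_orient e n F v :
  size v = n -> wsum n (fun u => (u == orient e v)%:R * F u) = F (orient e v).
Proof. by move=> sz_v; rewrite wsum_pred1 // size_orient. Qed.

Lemma wsum_weight_rot_le n i F :
    (forall u, 0 <= F u) ->
  wsum n (fun w => weight M w * F (rot i w)) <=
  wsum n (fun w => cweight M (n - i) w * F w).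
Proof.
move=> F_ge0; rewrite -[leRHS](wsum_rot _ i); apply: ler_wsum => w sz_w.
by rewrite ler_wpM2r // -sz_w weight_le_cweight_rot.
Qed.

(** The last [n - m] letters of the rotated word are free; summing them out costs [#|Q|%:R ^+ 2]. *)
Lemma wsum_weight_rot_take_le n m i F :
    (m <= n)%N -> (forall u, 0 <= F u) ->
  wsum n (fun w => weight M w * F (take m (rot i w))) <=
  #|Q|%:R ^+ 2 * wsum m (fun u => cweight M (n - i) u * F u).
Proof.
move=> le_mn F_ge0.
apply: le_trans (wsum_weight_rot_le n i (fun u => F_ge0 (take m u))) _.
rewrite -{1}(subnKC le_mn) wsum_cat -wsumZ; apply: ler_wsum => u sz_u.
apply: (@le_trans _ _ (wsum (n - m) (fun v =>
    cweight M (n - i - m) v * (cweight M (n - i) u * F u)))).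
  apply: ler_wsum => v _; rewrite take_size_cat // mulrA.
  by rewrite ler_wpM2r // mulrC -sz_u cweight_cat_le.
by rewrite wsumZr wsum_cweight.
Qed.

Section Bounds.
Variables (C r : R).
Hypothesis weight_sqr : forall m, wsum m (fun u => weight M u ^+ 2) <= C * r ^+ m.

(** The two sides of the cut are summed independently, and their lengths add up to [m]. *)
Lemma wsum_cweight_sqr_le m c :
  wsum m (fun u => cweight M c u ^+ 2) <= C ^+ 2 * r ^+ m.
Proof.
under eq_wsum do rewrite /cweight exprMn.
pose W u := weight M u ^+ 2; rewrite (wsum_take_drop m c W W).
have -> : C ^+ 2 * r ^+ m = (C * r ^+ minn c m) * (C * r ^+ (m - c)).
  by rewrite mulrACA -expr2 -exprD minnC minnE subnK ?leq_subr.
by rewrite ler_pM // wsum_ge0 // => u; apply: sqr_ge0.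
Qed.

(** By 2xy <= x^2 + y^2, where [orient e] permutes the words of length [m] and so does not affect
    the sum of squares. *)
Lemma wsum_cweight_orient_le e m c1 c2 :
  wsum m (fun u => cweight M c1 (orient e u) * cweight M c2 u) <= C ^+ 2 * r ^+ m.
Proof.
rewrite -(ler_pM2l (ltr0n R 2)) [leRHS]mulr_natl mulr2n.
apply: le_trans (lerD (wsum_cweight_sqr_le m c1) (wsum_cweight_sqr_le m c2)).
rewrite -(wsum_orient e m (fun u => cweight M c1 u ^+ 2)) -wsumD -wsumZ; apply: ler_wsum => u _.
by have := sqr_ge0 (cweight M c1 (orient e u) - cweight M c2 u); nra.
Qed.

(** For fixed [w], the factor of [w'] is prescribed and only its circular weight remains. Summing
    over [w] then pairs two circular weights of the same factor. Each word contributes one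
    [#|Q|%:R ^+ 2]. *)
Lemma wsum_cross_le e n m i j :
    (m <= n)%N ->
  wsum n (fun w => weight M w * wsum n (fun w' => weight M w' *
    (take m (rot i w') == orient e (take m (rot j w)))%:R))
  <= #|Q|%:R ^+ 4 * (C ^+ 2 * r ^+ m).
Proof.
move=> le_mn.
apply: (@le_trans _ _ (wsum n (fun w => weight M w *
    (#|Q|%:R ^+ 2 * cweight M (n - i) (orient e (take m (rot j w))))))).
  apply: ler_wsum => w sz_w; rewrite ler_wpM2l ?weight_ge0 //.
  set v := take m (rot j w).
  have sz_v : size v = m by rewrite size_takel // size_rot sz_w.
  rewrite -(wsum_pred1_orient e (cweight M (n - i)) sz_v).
  under [X in _ * X]eq_wsum do rewrite mulrC.
  exact: (wsum_weight_rot_take_le i (F := fun u => (u == orient e v)%:R)).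
under eq_wsum do rewrite mulrCA.
rewrite wsumZ -[4%N]/(2 + 2)%N exprD -mulrA ler_wpM2l ?exprn_ge0 //.
apply: le_trans (wsum_weight_rot_take_le j
  (F := fun u => cweight M (n - i) (orient e u)) le_mn _) _ => [u|].
  exact: cweight_ge0.
rewrite ler_wpM2l ?exprn_ge0 //; under eq_wsum do rewrite mulrC.
exact: wsum_cweight_orient_le.
Qed.

(** The two factors are disjoint, so the rotated word is a concatenation u v u' v' with u and u'
    tied together. The free parts v and v' are summed out at the cost of [#|Q|%:R ^+ 2] each. *)
Lemma wsum_self_le e n h a i :
    (h <= a)%N -> (a + h <= n)%N ->
  wsum n (fun w => weight M w *
    (take h (rot i w) == orient e (take h (drop a (rot i w))))%:R)
  <= #|Q|%:R ^+ 4 * (C ^+ 2 * r ^+ h).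
Proof.
move=> le_ha le_ahn.
apply: le_trans (wsum_weight_rot_le n i
  (F := fun z => (take h z == orient e (take h (drop a z)))%:R) _) _ => //.
set c := (n - i)%N; pose y := (a - h)%N; pose t := (n - (a + h))%N.
have Dn : n = (h + (y + (h + t)))%N by rewrite /y /t; lia.
rewrite [X in wsum X]Dn wsum_cat.
(* Positions of the cut relative to v, u' and v'; they stay at 0 once the cut is passed. *)
pose c1 := (c - h)%N; pose c2 := (c1 - y)%N; pose c3 := (c2 - h)%N.
apply: (@le_trans _ _ (wsum h (fun u => wsum y (fun v => wsum h (fun u' =>
    wsum t (fun v' => (cweight M c u * (u == orient e u')%:R * cweight M c2 u') *
      cweight M c1 v * cweight M c3 v')))))).
  apply: ler_wsum => u sz_u; rewrite wsum_cat; apply: ler_wsum => v sz_v.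
  rewrite wsum_cat; apply: ler_wsum => u' sz_u'; apply: ler_wsum => v' sz_v'.
  rewrite take_size_cat // catA drop_size_cat; last first.
    by rewrite size_cat sz_u sz_v /y subnKC.
  rewrite take_size_cat // -catA.
  rewrite [leRHS](_ : _ = (cweight M c u * (cweight M c1 v *
      (cweight M c2 u' * cweight M c3 v'))) * (u == orient e u')%:R); last by ring.
  rewrite ler_wpM2r //.
  apply: le_trans (cweight_cat_le M Q_gt0 _ _ _) _.
  rewrite ler_wpM2l ?cweight_ge0 // sz_u.
  apply: le_trans (cweight_cat_le M Q_gt0 _ _ _) _.
  rewrite ler_wpM2l ?cweight_ge0 // sz_v.
  by apply: le_trans (cweight_cat_le M Q_gt0 _ _ _) _; rewrite sz_u'.
under eq_wsum => u _.
  under eq_wsum => v _.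
    under eq_wsum => u' _ do rewrite wsumZ wsum_cweight.
    rewrite wsumZr wsumZr; over.
  rewrite wsumZr wsumZ wsum_cweight; over.
rewrite !wsumZr wsum_exchange.
rewrite [leLHS](_ : _ = #|Q|%:R ^+ 4 * wsum h (fun u' =>
  cweight M c (orient e u') * cweight M c2 u')).
  by rewrite ler_wpM2l ?exprn_ge0 // wsum_cweight_orient_le.
rewrite -mulrA -exprD mulrC; congr (_ * _); apply: eq_wsum => u' sz_u'.
rewrite wsumZr; congr (_ * _).
by under eq_wsum do rewrite mulrC; rewrite wsum_pred1_orient.
Qed.

End Bounds.
End Coincidences.

(** * Marginals and a union bound for independent variables of common law *)

Section ProductLaw.
Context {R : realType} {I U : finType} (L : U -> R).
Hypothesis L_sum1 : \sum_u L u = 1.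

Lemma product_law_expect (X : I -> U -> R) :
  \sum_(h : {ffun I -> U}) (\prod_i L (h i)) * \prod_i X i (h i) =
  \prod_i \sum_u L u * X i u.
Proof.
rewrite bigA_distr_bigA; apply: eq_bigr => h _.
by rewrite -big_split.
Qed.

Lemma product_law_sum1 : \sum_(h : {ffun I -> U}) \prod_i L (h i) = 1.
Proof. by rewrite -(bigA_distr_bigA (fun=> L)) big1. Qed.

Lemma product_law_marginal i (X : U -> R) :
  \sum_(h : {ffun I -> U}) (\prod_l L (h l)) * X (h i) = \sum_u L u * X u.
Proof.
pose Y l u := if l == i then X u else 1.
have Yi u : Y i u = X u by rewrite /Y eqxx.
have Y1 l u : l != i -> Y l u = 1 by rewrite /Y => /negPf->.
transitivity (\prod_l \sum_u L u * Y l u).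
  rewrite -product_law_expect; apply: eq_bigr => h _; congr (_ * _).
  rewrite (bigD1 i) //= Yi big1 ?mulr1 // => l neq_l; exact: Y1.
rewrite (bigD1 i) //= [X in _ * X]big1 => [|l neq_l].
  by rewrite mulr1; apply: eq_bigr => u _; rewrite Yi.
by rewrite -L_sum1; apply: eq_bigr => u _; rewrite Y1 ?mulr1.
Qed.

Lemma product_law_marginal2 i j (X : U -> U -> R) : i != j ->
  \sum_(h : {ffun I -> U}) (\prod_l L (h l)) * X (h i) (h j) =
  \sum_u L u * \sum_v L v * X u v.
Proof.
move=> neq_ij; have neq_ji : j == i = false by rewrite eq_sym (negPf neq_ij).
(* Splitting according to the value [u] of [h i] turns a function of two coordinates into a product
   of functions of one coordinate. *)
transitivity (\sum_u \sum_(h : {ffun I -> U})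
    (\prod_l L (h l)) * ((u == h i)%:R * X u (h j))).
  rewrite exchange_big; apply: eq_bigr => h _ /=.
  rewrite -mulr_sumr; congr (_ * _); rewrite (bigD1 (h i)) //= eqxx mul1r big1 ?addr0 // => u /negPf->.
  by rewrite mul0r.
apply: eq_bigr => u _.
pose Y l v := if l == i then (u == v)%:R else if l == j then X u v else 1.
have Yi v : Y i v = (u == v)%:R by rewrite /Y eqxx.
have Yj v : Y j v = X u v by rewrite /Y neq_ji eqxx.
have Y1 l v : (l != i) && (l != j) -> Y l v = 1.
  by rewrite /Y => /andP[/negPf-> /negPf->].
transitivity (\prod_l \sum_v L v * Y l v).
  rewrite -product_law_expect; apply: eq_bigr => h _; congr (_ * _).
  rewrite (bigD1 i) //= (bigD1 j) ?neq_ji //= Yi Yj big1 ?mulr1 // => l neq_l.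
  exact: Y1.
rewrite (bigD1 i) //= (bigD1 j) ?neq_ji //= [X in _ * (_ * X)]big1 => [|l neq_l].
  rewrite mulr1; congr (_ * _); last by apply: eq_bigr => v _; rewrite Yj.
  rewrite (bigD1 u) //= Yi eqxx mulr1 big1 ?addr0 // => v neq_v.
  by rewrite Yi eq_sym (negPf neq_v) mulr0.
by rewrite -L_sum1; apply: eq_bigr => v _; rewrite Y1 ?mulr1.
Qed.

Lemma product_law_union_bound (E : finType) (P : pred {ffun I -> U})
    (X : E -> {ffun I -> U} -> bool) :
    (forall u, 0 <= L u) ->
    (forall h, ~~ P h -> exists e, X e h) ->
  1 - \sum_(h | P h) \prod_i L (h i) <=
  \sum_e \sum_(h : {ffun I -> U}) (\prod_i L (h i)) * (X e h)%:R.
Proof.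
move=> L_ge0 coverX.
have L_prod_ge0 (h : {ffun I -> U}) : 0 <= \prod_i L (h i) by apply: prodr_ge0.
rewrite -[X in X - _]product_law_sum1 [X in X - _](bigID P) /= addrAC subrr add0r.
rewrite exchange_big big_mkcond; apply: ler_sum => h _ /=.
have sum_ge0 (p : pred E) : 0 <= \sum_(e | p e) (\prod_i L (h i)) * (X e h)%:R.
  by apply: sumr_ge0 => e _; rewrite mulr_ge0.
case: ifPn => // /coverX[e Xe]; rewrite (bigD1 e) //= Xe mulr1 lerDl.
exact: sum_ge0.
Qed.

Lemma product_law_prob_le1 (P : pred {ffun I -> U}) :
  (forall u, 0 <= L u) -> \sum_(h | P h) \prod_i L (h i) <= 1.
Proof.
move=> L_ge0; rewrite -[leRHS]product_law_sum1 [leRHS](bigID P) /= lerDl.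
by apply: sumr_ge0 => h _; apply: prodr_ge0.
Qed.

End ProductLaw.

(** * The conditional law on cyclically reduced words, dominated by the weight *)

Section CycLaw.
Context {R : realType} {A Q : finType} (M : markov_automaton R A Q).
Variables (n : nat) (c : R).
Hypothesis c_gt0 : 0 < c.
Hypothesis mass_ge : c <=
  \sum_(v : n.-tuple (letter A) | cyc_reduced v) init_word M v.

Let mass_gt0 := lt_le_trans c_gt0 mass_ge.

Lemma cyc_law_ge0 (u : n.-tuple (letter A)) : 0 <= cyc_law M u.
Proof.
rewrite divr_ge0 //; last exact: ltW.
by case: ifP => // _; apply: init_word_ge0.
Qed.

Lemma cyc_law_sum1 : \sum_(u : n.-tuple (letter A)) cyc_law M u = 1.
Proof. by rewrite -mulr_suml -big_mkcond divff // gt_eqF. Qed.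

Lemma cyc_law_le_weight (u : n.-tuple (letter A)) :
  cyc_law M u <= c^-1 * weight M u.
Proof.
rewrite mulrC ler_pM ?invr_ge0 ?(ltW mass_gt0) //.
- by case: ifP => // _; apply: init_word_ge0.
- by case: ifP => _; rewrite ?weight_ge0 ?init_word_le_weight.
- by rewrite lef_pV2 ?posrE.
Qed.

End CycLaw.

(** * Combinatorics of repeated circular factors *)

Section CircularFactors.
Context {A : finType}.
Implicit Types (u v w : word A) (n m h a b i s t : nat) (e : bool).

Lemma nth_winv x0 w i :
  (i < size w)%N -> nth x0 (winv w) i = linv (nth x0 w (size w - i.+1)).
Proof.
move=> lt_i; rewrite /winv nth_rev size_map // (nth_map x0) //.
by rewrite ltn_subrL (leq_ltn_trans _ lt_i).
Qed.

Lemma nth_rot_mod (T : Type) (x0 : T) s (w : seq T) i :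
  (i < size w)%N -> (s <= size w)%N ->
  nth x0 (rot s w) i = nth x0 w ((s + i) %% size w).
Proof.
move=> lt_i le_s; rewrite /rot nth_cat size_drop nth_drop.
case: ltnP => lt_is; first by rewrite modn_small //; lia.
rewrite nth_take; last by lia.
have -> : (s + i = (i - (size w - s)) + size w)%N by lia.
by rewrite modnDr modn_small //; lia.
Qed.

(* For [f] and [g] the periodic extensions of [w] and [w'] this means
   [take m (rot a w) = orient e (take m (rot b w'))], see [take_rot_eqP]. *)
Definition coincide e m (f g : nat -> letter A) a b : Prop :=
  forall i, (i < m)%N ->
    f (a + i)%N = if e then linv (g (b + (m - i.+1))%N) else g (b + i)%N.

Definition periodic x0 w i : letter A := nth x0 w (i %% size w).

Lemma periodicD x0 w i : periodic x0 w (i + size w) = periodic x0 w i.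
Proof. by rewrite /periodic modnDr. Qed.

Lemma nth_orient x0 e u i :
  (i < size u)%N ->
  nth x0 (orient e u) i = if e then linv (nth x0 u (size u - i.+1)) else nth x0 u i.
Proof. by case: e => //= /nth_winv. Qed.

Lemma eq_orientP x0 e u v : size u = size v ->
  (forall i, (i < size u)%N ->
     nth x0 u i = if e then linv (nth x0 v (size v - i.+1)) else nth x0 v i) <->
  u = orient e v.
Proof.
move=> eq_sz; split=> [eq_nth|-> i]; last by rewrite size_orient; apply: nth_orient.
apply: (@eq_from_nth _ x0) => [|i lt_i]; first by rewrite size_orient.
by rewrite eq_nth // nth_orient -?eq_sz.
Qed.

Lemma take_rot_eqP x0 e m n w w' a b :
    size w = n -> size w' = n -> (m <= n)%N -> (a <= n)%N -> (b <= n)%N ->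
  take m (rot a w) = orient e (take m (rot b w')) <->
  coincide e m (periodic x0 w) (periodic x0 w') a b.
Proof.
move=> sz_w sz_w' le_mn le_an le_bn.
have sz_u : size (take m (rot a w)) = m by rewrite size_takel ?size_rot ?sz_w.
have sz_u' : size (take m (rot b w')) = m by rewrite size_takel ?size_rot ?sz_w'.
have nth_u i : (i < m)%N -> nth x0 (take m (rot a w)) i = periodic x0 w (a + i).
  by move=> lt_im; rewrite /periodic nth_take // nth_rot_mod ?sz_w //; lia.
have nth_u' i : (i < m)%N -> nth x0 (take m (rot b w')) i = periodic x0 w' (b + i).
  by move=> lt_im; rewrite /periodic nth_take // nth_rot_mod ?sz_w' //; lia.
rewrite -(eq_orientP x0) ?sz_u ?sz_u' //; split=> eq_nth i lt_im.
  by rewrite -nth_u // eq_nth // !nth_u' //; lia.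
by rewrite nth_u // eq_nth // !nth_u' //; lia.
Qed.

Lemma take_drop_rot_eqP x0 e n h s w a :
    size w = n -> (a <= n)%N -> (s + h <= n)%N ->
  coincide e h (periodic x0 w) (periodic x0 w) a (a + s) ->
  take h (rot a w) = orient e (take h (drop s (rot a w))).
Proof.
move=> sz_w le_an le_shn co.
have sz_u : size (take h (rot a w)) = h by rewrite size_takel // size_rot sz_w; lia.
have sz_u' : size (take h (drop s (rot a w))) = h.
  by rewrite size_takel // size_drop size_rot sz_w; lia.
apply/(eq_orientP x0); rewrite ?sz_u' ?sz_u // => i lt_ih.
have nth_u t : (t < n)%N -> nth x0 (rot a w) t = periodic x0 w (a + t).
  by move=> lt_t; rewrite /periodic nth_rot_mod ?sz_w.
rewrite nth_take // nth_u ?co //; last by lia.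
by case: (e); rewrite nth_take ?nth_drop ?nth_u ?addnA //; lia.
Qed.

Lemma coincide_sym e m f g a b : coincide e m f g a b -> coincide e m g f b a.
Proof.
case: e => co i lt_im /=; last by rewrite co.
have lt_i' : (m - i.+1 < m)%N by lia.
rewrite co // linvK; congr (g _); lia.
Qed.

(** Going around the circle, one occurrence follows the other at distance [b - a] or [n - (b - a)].
    If the first distance leaves no room for [m] more letters, it exceeds [n - m], and the second
    one fits because [2m <= n]. Only inverse occurrences may start at the same place. *)
Lemma coincide_shift m n f a b :
    (forall i, f (i + n)%N = f i) -> (m.*2 <= n)%N -> (a < n)%N -> (b < n)%N ->
  forall e, coincide e m f f a b -> e || (a != b) ->
  exists a' t, [/\ (a' < n)%N, (t + m <= n)%N, e || (0 < t)%N &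
    coincide e m f f a' (a' + t)].
Proof.
move=> f_per le_mn; wlog le_ab : a b / (a <= b)%N.
  move=> IH lt_an lt_bn e co ab; have [le_ab|lt_ba] := leqP a b.
    exact: (IH a b).
  by apply: (IH b a) => //; [exact: ltnW | exact: coincide_sym | rewrite eq_sym].
move=> lt_an lt_bn e co neq_ab.
have [le_n|lt_n] := leqP ((b - a) + m) n.
  exists a, (b - a)%N; split=> //; last by rewrite subnKC.
  by case: (e) neq_ab => //= neq_ab; rewrite subn_gt0 ltn_neqAle neq_ab.
exists b, (n - (b - a))%N; split=> //; try lia.
have co' := coincide_sym co; move=> i lt_im; rewrite co' //.
have Eb t : (b + (n - (b - a)) + t = (a + t) + n)%N by lia.
by rewrite !Eb !f_per.
Qed.

(** The two occurrences may overlap; halving their length leaves room to make them disjoint. *)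
Lemma coincide_halve e m f a t :
    coincide e m f f a (a + t) -> e || (0 < t)%N ->
  exists s, [/\ (m./2 <= s)%N, (s + m./2 <= t + m)%N &
    coincide e m./2 f f a (a + s)].
Proof.
set h := m./2; have le_hm : (h.*2 <= m)%N by rewrite /h; lia.
case: e => co /= t_gt0.
  (* Inversion matches the first half of one occurrence with the last half of the other. *)
  exists (t + (m - h))%N; split; try lia.
  move=> i lt_ih; rewrite co; last by lia.
  by congr (linv (f _)); lia.
(* A word of length t + m with period t also has all multiples of t as periods. *)
have per k i : (i + t * k < t + m)%N -> f (a + i)%N = f (a + i + t * k)%N.
  elim: k => [|k IHk] lt_ik; first by rewrite muln0 addn0.
  rewrite IHk; last by rewrite mulnS in lt_ik; lia.
  have := co (i + t * k)%N; rewrite addnA => ->; last by rewrite mulnS in lt_ik; lia.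
  by congr (f _); rewrite mulnS; lia.
have := divn_eq h t; have := ltn_pmod h t_gt0; set k := (h %/ t)%N => lt_mod Dh.
have Dk : (t * k.+1 = k * t + t)%N by rewrite mulnS mulnC addnC.
(* The least multiple of [t] above [h]; it is at most [h + t], so the second factor ends within
   [t + m]. *)
exists (t * k.+1)%N; rewrite Dk; split; try lia.
move=> i lt_ih; rewrite (per k.+1) ?Dk; last by lia.
by congr (f _); lia.
Qed.

(** Inversion reverses positions, so the factor starts at [- (a + m)] modulo [n] in [w]; the
    conditional is that residue. *)
Lemma take_rot_winv n m w a :
    size w = n -> (0 < m <= n)%N -> (a < n)%N ->
  take m (rot a (winv w)) =
  winv (take m (rot (if (a + m <= n) then n - (a + m) else n.*2 - (a + m))%N w)).
Proof.
move=> sz_w /andP[m_gt0 le_mn] lt_an; set a' := (X in rot X w).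
have le_a'n : (a' <= n)%N by rewrite /a'; case: ifP; lia.
have x0 : letter A by case: w sz_w lt_an => [|x w] <-.
apply/(take_rot_eqP x0 true (n := n)); rewrite ?size_winv //; first by lia.
move=> i lt_im; rewrite /periodic size_winv nth_winv ?ltn_pmod; try lia.
rewrite sz_w; congr (linv (nth _ _ _)); rewrite /a'.
have [lt_ain|le_nai] := ltnP (a + i) n.
  rewrite [((a + i) %% n)%N]modn_small //; case: ifP => le_amn.
    by rewrite modn_small; lia.
  have -> : (n.*2 - (a + m) + (m - i.+1) = (n - (a + i).+1) + n)%N by lia.
  by rewrite modnDr modn_small //; lia.
have -> : (a + i = (a + i - n) + n)%N by lia.
rewrite modnDr [((a + i - n) %% n)%N]modn_small; last by lia.
by rewrite ifF ?modn_small //; lia.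
Qed.

End CircularFactors.

(** * Repetitions forced by a failure of the small cancellation property *)

Section SmallCancellationFailure.
Context {A : finType}.
Implicit Types (u w : word A) (ws : seq (word A)) (n m h : nat) (o : nat * nat).

Lemma nth_sym_tuple ws (o1 : nat) :
  (o1 < size (sym_tuple ws))%N ->
  nth [::] (sym_tuple ws) o1 = orient (odd o1) (nth [::] ws o1./2) /\
  (o1./2 < size ws)%N.
Proof.
elim: ws o1 => [|w ws IHws] [|[|o1]] //= lt_o1.
have [-> lt_o1'] := IHws o1 lt_o1.
by rewrite negbK ltnS.
Qed.

(** This moves each occurrence to a word of the tuple itself, keeping only an orientation bit from
    the symmetrised tuple. *)
Lemma occurs_take n m ws u o :
    (forall w, w \in ws -> size w = n) -> (0 < m <= n)%N -> (m <= size u)%N ->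
    occurs ws u o ->
  [/\ (o.1./2 < size ws)%N, (o.2 < n)%N & take m u =
    orient (odd o.1) (take m (rot (if ~~ odd o.1 then o.2 else
      if (o.2 + m <= n) then n - (o.2 + m) else n.*2 - (o.2 + m))%N
    (nth [::] ws o.1./2)))].
Proof.
move=> sz_ws m_n le_mu /and3P[/nth_sym_tuple[-> lt_o1]].
have sz_w : size (nth [::] ws o.1./2) = n by rewrite sz_ws ?mem_nth.
rewrite size_orient sz_w => lt_o2 pref_u; split=> //.
have -> : take m u = take m (rot o.2 (orient (odd o.1) (nth [::] ws o.1./2))).
  by move: pref_u; rewrite prefixE => /eqP{1}<-; rewrite take_takel.
by case: (odd o.1) => //=; rewrite (take_rot_winv sz_w m_n lt_o2).
Qed.

(** A piece violating the bound has at least [m] letters, and its first [m] letters occur twice.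
    Occurrences in different words give the first alternative; those in one word are brought to the
    second by [coincide_shift] and [coincide_halve]. *)
Lemma not_small_cancellation (R : realType) (lambda : R) n m ws :
    (forall w, w \in ws -> size w = n) ->
    (0 < m)%N -> (m.*2 <= n)%N -> m%:R <= lambda * n%:R ->
    ~ small_cancellation lambda ws ->
  (exists i j a b e, [/\ (i < size ws)%N, (j < size ws)%N, i != j,
     (a < n)%N && (b < n)%N &
     take m (rot a (nth [::] ws j)) = orient e (take m (rot b (nth [::] ws i)))]) \/
  (exists i a s e, [/\ (i < size ws)%N, (a < n)%N, (m./2 <= s)%N, (s + m./2 <= n)%N &
     let z := rot a (nth [::] ws i) in
     take m./2 z = orient e (take m./2 (drop s z))]).
Proof.
move=> sz_ws m_gt0 le_mn le_m not_sc.
have [u [ o [piece_u occ_o le_u]]] : exists u o, [/\ piece ws u, occurs ws u o &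
    lambda * (size (nth [::] (sym_tuple ws) o.1))%:R <= (size u)%:R].
  apply/not_existsP => no_u; apply: not_sc => u o piece_u occ_o.
  by rewrite ltNge; apply/negP => le_u; case: (no_u u); exists o.
have le_mu : (m <= size u)%N.
  rewrite -(ler_nat R) (le_trans le_m) //; apply: le_trans le_u.
  case/and3P: occ_o => /nth_sym_tuple[-> lt_o1] _ _.
  by rewrite size_orient sz_ws // mem_nth.
have m_n : (0 < m <= n)%N by lia.
case: piece_u => o1 [ o2 [neq_o occ1 occ2]].
have [lt1 lt_a1 Du1] := occurs_take sz_ws m_n le_mu occ1.
have [lt2 lt_a2 Du2] := occurs_take sz_ws m_n le_mu occ2.
move: Du1 Du2; set a1 := (X in rot X _); set a2 := (X in _ -> _ = orient _ (take _ (rot X _)) -> _).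
move=> Du1 Du2.
have lt_a1n : (a1 < n)%N by rewrite /a1; do !case: ifP; lia.
have lt_a2n : (a2 < n)%N by rewrite /a2; do !case: ifP; lia.
pose e := odd o1.1 (+) odd o2.1.
have eq_f : take m (rot a1 (nth [::] ws o1.1./2)) =
    orient e (take m (rot a2 (nth [::] ws o2.1./2))).
  apply: (can_inj (orientK (odd o1.1))); rewrite -Du1 Du2 /e.
  by case: (odd o1.1); case: (odd o2.1) => //=; rewrite winvK.
have [eq_i|neq_i] := eqVneq (o1.1./2) (o2.1./2); last first.
  by left; exists (o2.1./2), (o1.1./2), a1, a2, e; rewrite eq_sym lt_a1n lt_a2n.
right; set w := nth [::] ws o2.1./2.
have sz_w : size w = n by rewrite sz_ws ?mem_nth.
have x0 : letter A by case: w sz_w => [|x w'] //= sz_w; lia.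
have co : coincide e m (periodic x0 w) (periodic x0 w) a1 a2.
  move: eq_f; rewrite eq_i -/w => eq_f.
  by apply/(take_rot_eqP x0 e sz_w sz_w) => //; lia.
have f_per k : periodic x0 w (k + n) = periodic x0 w k by rewrite -sz_w periodicD.
(* With equal orientations, equal starts would give equal [o.2], hence the same occurrence. *)
have neq_a : e || (a1 != a2).
 case: eqP => [|_]; rewrite ?orbT // orbF /e /a1 /a2.
  have [eq_odd|neq_odd] := eqVneq (odd o1.1) (odd o2.1); last first.
    by rewrite -negb_eqb neq_odd.
move=> eq_a; case: neq_o; rewrite (surjective_pairing o1) (surjective_pairing o2).
  congr pair; first by rewrite -(odd_double_half o1.1) eq_odd eq_i odd_double_half.
  by move: eq_a; rewrite eq_odd; do !case: ifP; lia.
have [a' [t [lt_a' le_tm t_gt0 co']]] :=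
  coincide_shift f_per le_mn lt_a1n lt_a2n co neq_a.
have [s [le_hs le_sh co'']] := coincide_halve co' t_gt0.
exists (o2.1./2), a', s, e; split=> //; first by lia.
by apply: (take_drop_rot_eqP (x0 := x0) sz_w) => //; lia.
Qed.

End SmallCancellationFailure.

(** * The union bound on the probability of failure *)

Section FailureBound.
Context {R : realType} {A Q : finType} (M : markov_automaton R A Q).
Hypothesis Q_gt0 : (0 < #|Q|)%N.
Variables (C r : R).
Hypothesis C_ge0 : 0 <= C.
Hypothesis r_gt0 : 0 < r.
Hypothesis weight_sqr : forall m, wsum m (fun u => weight M u ^+ 2) <= C * r ^+ m.
Variables (n : nat) (c : R).
Hypothesis c_gt0 : 0 < c.
Hypothesis mass_ge : c <=
  \sum_(v : n.-tuple (letter A) | cyc_reduced v) init_word M v.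

Local Notation law := (@cyc_law R A Q M n).

Lemma cyc_law_cross_le e m i j : (m <= n)%N ->
  \sum_u law u * \sum_v law v *
    (take m (rot i v) == orient e (take m (rot j u)))%:R
  <= c^-1 ^+ 2 * (#|Q|%:R ^+ 4 * (C ^+ 2 * r ^+ m)).
Proof.
move=> le_mn; have c'_ge0 : 0 <= c^-1 by rewrite invr_ge0 ltW.
have leW := cyc_law_le_weight c_gt0 mass_ge.
have law_ge0 := cyc_law_ge0 c_gt0 mass_ge.
have crossW := wsum_cross_le Q_gt0 weight_sqr e i j le_mn.
apply: le_trans (ler_wpM2l (exprn_ge0 2 c'_ge0) crossW).
rewrite /wsum expr2 -mulrA !mulr_sumr; apply: ler_sum => u _.
rewrite [leRHS](_ : _ = (c^-1 * weight M u) * \sum_(v : n.-tuple (letter A))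
  (c^-1 * (weight M v * (take m (rot i v) == orient e (take m (rot j u)))%:R))).
  rewrite ler_pM ?leW ?law_ge0 //.
    by apply: sumr_ge0 => v _; rewrite mulr_ge0.
  by apply: ler_sum => v _; rewrite mulrA ler_wpM2r ?leW.
by rewrite -mulr_sumr; ring.
Qed.

Lemma cyc_law_self_le e h a i : (h <= a)%N -> (a + h <= n)%N ->
  \sum_u law u * (take h (rot i u) == orient e (take h (drop a (rot i u))))%:R
  <= c^-1 * (#|Q|%:R ^+ 4 * (C ^+ 2 * r ^+ h)).
Proof.
move=> le_ha le_ahn; have c'_ge0 : 0 <= c^-1 by rewrite invr_ge0 ltW.
apply: le_trans (ler_wpM2l c'_ge0
  (wsum_self_le Q_gt0 weight_sqr e i le_ha le_ahn)).
rewrite /wsum mulr_sumr; apply: ler_sum => u _.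
by rewrite mulrA ler_wpM2r ?(cyc_law_le_weight c_gt0 mass_ge).
Qed.

Lemma small_cancellation_failure_le (lambda : R) k m :
    (1 < m)%N -> (m.*2 <= n)%N -> m%:R <= lambda * n%:R ->
  1 - tuple_prob M n k (small_cancellation lambda) <=
  ((k * k) * (n * n) * 2)%:R * (c^-1 ^+ 2 * (#|Q|%:R ^+ 4 * (C ^+ 2 * r ^+ m))) +
  (k * (n * n) * 2)%:R * (c^-1 * (#|Q|%:R ^+ 4 * (C ^+ 2 * r ^+ m./2))).
Proof.
move=> m_gt1 le_mn le_m.
(* The events are indexed by words, positions and an orientation. Indices violating the side
   conditions are kept for easy counting; [X] makes their events empty. *)
pose E1 : finType := ('I_k * 'I_k * ('I_n * 'I_n) * bool)%type.
pose E2 : finType := ('I_k * ('I_n * 'I_n) * bool)%type.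
pose U := n.-tuple (letter A).
pose X (e : E1 + E2) (h : {ffun 'I_k -> U}) : bool :=
  match e with
  | inl (i, j, (a, b), e) => (i != j) &&
      (take m (rot a (h j)) == orient e (take m (rot b (h i))))
  | inr (i, (a, s), e) => [&& (m./2 <= s)%N, (s + m./2 <= n)%N &
      take m./2 (rot a (h i)) == orient e (take m./2 (drop s (rot a (h i))))]
  end.
have law_ge0 := cyc_law_ge0 c_gt0 mass_ge.
have law_sum1 := cyc_law_sum1 c_gt0 mass_ge.
rewrite /tuple_prob.
apply: le_trans (product_law_union_bound (X := X) law_sum1 law_ge0 _) _.
  move=> h /asboolPn; set ws := [seq _ | _ <- _] => not_sc.
  have sz_ws : size ws = k by rewrite size_map size_enum_ord.
  have nth_ws i (lt_i : (i < k)%N) : nth [::] ws i = h (Ordinal lt_i).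
    rewrite (nth_map (Ordinal lt_i)) ?size_enum_ord //; congr (tval (h _)).
    exact: (nth_ord_enum _ (Ordinal lt_i)).
  have ws_n w : w \in ws -> size w = n.
    by case/mapP => i _ ->; rewrite size_tuple.
  have [] := not_small_cancellation ws_n (ltnW m_gt1) le_mn le_m not_sc.
    case=> i [j [a [b [e []]]]]; rewrite sz_ws => lt_i lt_j neq_ij /andP[lt_a lt_b].
    rewrite !nth_ws => eq_f.
    exists (inl (Ordinal lt_i, Ordinal lt_j, (Ordinal lt_a, Ordinal lt_b), e)).
    by rewrite /X /= eq_f eqxx andbT.
  case=> i [a [s [e []]]]; rewrite sz_ws => lt_i lt_a le_s le_sn.
  have lt_s : (s < n)%N by lia.
  rewrite nth_ws /= => eq_f.
  exists (inr (Ordinal lt_i, (Ordinal lt_a, Ordinal lt_s), e)).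
  by rewrite /X /= le_s le_sn eq_f eqxx.
rewrite big_sumType /=; apply: lerD.
  have -> : ((k * k) * (n * n) * 2)%N = #|E1|.
    by rewrite !card_prod !card_ord card_bool.
  rewrite mulr_natl -sumr_const; apply: ler_sum => -[[[i j] [a b]] e] _ /=.
  have [->|neq_ij] := eqVneq i j.
    rewrite big1 => [|h _]; last by rewrite mulr0.
    by rewrite !mulr_ge0 ?exprn_ge0 ?invr_ge0 ?(ltW c_gt0) ?(ltW r_gt0).
  rewrite (product_law_marginal2 law_sum1
    (fun u v : U => (take m (rot a v) == orient e (take m (rot b u)))%:R) neq_ij).
  by apply: cyc_law_cross_le; lia.
have -> : (k * (n * n) * 2)%N = #|E2|.
  by rewrite !card_prod !card_ord card_bool.
rewrite mulr_natl -sumr_const; apply: ler_sum => -[[i [a s]] e] _ /=.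
rewrite (product_law_marginal law_sum1 i (fun u : U =>
  [&& (m./2 <= s)%N, (s + m./2 <= n)%N &
      take m./2 (rot a u) == orient e (take m./2 (drop s (rot a u)))]%:R)).
case: (leqP m./2 s) => /= [le_s|_]; last first.
  rewrite big1 => [|h _]; last by rewrite mulr0.
  by rewrite !mulr_ge0 ?exprn_ge0 ?invr_ge0 ?(ltW c_gt0) ?(ltW r_gt0).
case: leqP => /= [le_sn|_]; last first.
  rewrite big1 => [|h _]; last by rewrite mulr0.
  by rewrite !mulr_ge0 ?exprn_ge0 ?invr_ge0 ?(ltW c_gt0) ?(ltW r_gt0).
exact: cyc_law_self_le.
Qed.

Lemma tuple_prob_le1 k (P : seq (word A) -> Prop) : tuple_prob M n k P <= 1.
Proof.
apply: product_law_prob_le1 (cyc_law_sum1 c_gt0 mass_ge) _ _.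
exact: cyc_law_ge0 c_gt0 mass_ge.
Qed.

End FailureBound.

(** * Exponential estimates and the choice of the rate *)

Section Asymptotics.
Context {R : realType}.

Lemma exp_generic_of_sqr_expR_bound (s : nat -> R) (K gamma : R) (N : nat) :
    0 < gamma ->
    (forall n, (N <= n)%N -> 0 <= 1 - s n <= K * n%:R ^+ 2 * expR (- (gamma * n%:R))) ->
  exp_generic s.
Proof.
move=> gamma_gt0 s_bound; exists (gamma / 2); first by rewrite divr_gt0.
apply/eqoP => eps eps_gt0.
(* Half of the decay is given up and split in three: the cube of [expR (b * n%:R) >= b * n%:R]
   dominates the factor [n%:R ^+ 2]. *)
pose b := gamma / 6; have b_gt0 : 0 < b by rewrite divr_gt0.
near=> n.
have /andP[s_ge0 s_le] : 0 <= 1 - s n <= K * n%:R ^+ 2 * expR (- (gamma * n%:R)).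
  by apply: s_bound; near: n; apply: nbhs_infty_ge.
rewrite !ger0_norm ?expR_ge0 //; apply: le_trans s_le _.
have -> : - (gamma * n%:R) = - (gamma / 2 * n%:R) - (3%:R * (b * n%:R)) :> R.
  by rewrite /b; field.
rewrite expRD [X in _ <= X]mulrC mulrCA ler_wpM2l ?expR_ge0 //.
rewrite expRN ler_pdivrMr ?expR_gt0 // expRM_natl.
have le_n : K / (eps * b ^+ 3) <= n%:R.
  by near: n; apply: nbhs_infty_ger.
have bn_ge0 : 0 <= b * n%:R by rewrite mulr_ge0 // ltW.
apply: (@le_trans _ _ (eps * (b * n%:R) ^+ 3)).
  move: le_n; rewrite ler_pdivrMr ?mulr_gt0 ?exprn_gt0 // => le_K.
  rewrite [leRHS](_ : _ = n%:R * (eps * b ^+ 3) * n%:R ^+ 2); last by ring.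
  by rewrite ler_wpM2r ?sqr_ge0.
rewrite ler_pM2l // lerXn2r ?nnegrE ?expR_ge0 //.
by apply: le_trans (expR_ge1Dx _); rewrite lerDr.
Unshelve. all: by end_near. Qed.

(* The choice of [rho] interpolates: [expR rho] is slightly above [alpha], but its
   power [lambda / 2] still beats the density, which is possible as [d < lambda / 2]. *)
Lemma density_size_expR_le (alpha lambda d : R) :
    0 <= alpha < 1 -> 0 < lambda -> 0 < d < lambda / 2 ->
  exists rho gamma, [/\ rho < 0, 0 < gamma, alpha < expR rho &
    forall n, (0 < n)%N ->
      (density_size alpha d n)%:R * expR (rho * (lambda / 2 * n%:R)) <=
      expR (- (gamma * n%:R))].
Proof.
move=> /andP[alpha_ge0 alpha_lt1] lambda_gt0 /andP[d_gt0 d_lt].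
(* Here 0 to a nonzero power is 0, so the tuple is empty for [0 < n] and any admissible rates do. *)
have [->|alpha_neq0] := eqVneq alpha 0.
  exists (- 1), 1; split; rewrite ?ltrN10 ?ltr01 ?expR_gt0 // => n n_gt0.
  rewrite /density_size powR0 ?truncn0 ?mul0r ?expR_ge0 //.
  by rewrite oppr_eq0 mulf_neq0 ?gt_eqF // ltr0n.
have alpha_gt0 : 0 < alpha by rewrite lt0r alpha_neq0.
pose l := ln alpha; have l_lt0 : l < 0 by rewrite ln_lt0 ?alpha_gt0.
(* The midpoint of [2 * d / lambda] and 1. *)
pose theta := (lambda + 2 * d) / (2 * lambda).
have theta_gt0 : 0 < theta by rewrite divr_gt0 ?addr_gt0 ?mulr_gt0.
have theta_lt1 : theta < 1 by rewrite ltr_pdivrMr ?mulr_gt0 // mul1r; lra.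
exists (theta * l), (- l * ((lambda / 2 - d) / 2)); split.
- by rewrite pmulr_rlt0.
- by rewrite mulr_gt0 ?oppr_gt0 // divr_gt0 // subr_gt0.
- rewrite -[ltLHS]lnK ?posrE // ltr_expR -/l.
  by rewrite -subr_gt0 -{2}[l]mul1r -mulrBl nmulr_lgt0 // subr_lt0.
move=> n n_gt0; rewrite /density_size.
apply: (@le_trans _ _ (alpha `^ (- (d * n%:R)) * expR (theta * l * (lambda / 2 * n%:R)))).
  by rewrite ler_wpM2r ?expR_ge0 // truncn_le powR_ge0.
rewrite /powR (negPf alpha_neq0) -expRD ler_expR -/l /theta le_eqVlt.
by apply/orP; left; apply/eqP; field; rewrite gt_eqF.
Qed.

Lemma spectral_radius_ge0 n (B : 'M[R]_n) : 0 <= spectral_radius B.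
Proof.
rewrite /spectral_radius; set E := (X in sup X).
have [->|/set0P E_nz] := eqVneq E set0; first by rewrite sup0.
case: (E_nz) => _ [z eig_z _].
by apply: le_trans (eigenvalue_le_spectral_radius eig_z); rewrite -ler0c normc_Re.
Qed.

End Asymptotics.

Theorem proposition4p16 (R : realType) (A Q : finType)
    (hA : (0 < #|A|)%N) (hQ : (0 < #|Q|)%N)
    (M : markov_automaton R A Q) (g : 'rV[R]_#|Q|)
    (hsupp : reduced_support M)
    (herg : ergodic M)
    (hstat : stationary M g)
    (hnondeg : non_degenerate M g)
    (hcycle : ~ has_prob1_cycle M)
    (lambda d : R)
    (hlambda : 0 < lambda < 1 / 2)
    (hd : 0 < d < lambda / 2) :
  exp_generic (fun n =>
    tuple_prob M n (density_size (coincidence M) d n)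
      (small_cancellation lambda)).
Proof.
have /andP[lambda_gt0 lambda_lt] := hlambda.
have alpha_01 : 0 <= coincidence M < 1.
  by rewrite spectral_radius_ge0 coincidence_lt1.
have [rho [gamma [rho_lt0 gamma_gt0 lt_rho size_le]]] :=
  density_size_expR_le alpha_01 lambda_gt0 hd.
set r := expR rho in lt_rho; have r_gt0 : 0 < r by exact: expR_gt0.
have [C C_ge0 weight_sqr] := weight_sqr_bound (ergodic_edge_to herg) r_gt0 lt_rho.
have [c c_gt0 [N mass_ge]] := cyc_reduced_mass_lb herg hstat hnondeg hsupp.
pose D := #|Q|%:R ^+ 4 * C ^+ 2; pose K1 := c^-1 ^+ 2 * D; pose K2 := c^-1 * D.
have D_ge0 : 0 <= D by rewrite mulr_ge0 ?exprn_ge0.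
have c'_ge0 : 0 <= c^-1 by rewrite invr_ge0 ltW.
have K1_ge0 : 0 <= K1 by rewrite mulr_ge0 ?exprn_ge0.
have K2_ge0 : 0 <= K2 by rewrite mulr_ge0.
(* The 2 counts orientations, and [expR (- rho)], the inverse of [r], pays for rounding [m] and
   [m./2]. The threshold ensures [2 <= lambda * n%:R], hence [1 < m]. *)
apply: (exp_generic_of_sqr_expR_bound (K := 2 * (K1 + K2) * expR (- rho))
  (N := maxn N (Num.truncn (2 / lambda)).+1) gamma_gt0) => n.
rewrite geq_max => /andP[le_Nn lt_n]; set k := density_size _ _ _.
rewrite subr_ge0 (tuple_prob_le1 c_gt0 (mass_ge n le_Nn)) /=.
have ln_ge2 : 2 <= lambda * n%:R.
  rewrite mulrC -ler_pdivrMr // ltW //.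
  have /andP[_ lt_2] := truncn_itv (divr_ge0 (ler0n R 2) (ltW lambda_gt0)).
  by apply: lt_le_trans lt_2 _; rewrite ler_nat.
have n_gt0 : (0 < n)%N by apply: leq_trans lt_n.
have ln_ge0 : 0 <= lambda * n%:R by rewrite (le_trans _ ln_ge2).
pose m := Num.truncn (lambda * n%:R).
have /andP[m_le m_gt] := truncn_itv ln_ge0; rewrite -/m in m_le m_gt.
have m_gt1 : (1 < m)%N.
  by rewrite -ltnS -(ltr_nat R); apply: le_lt_trans m_gt.
have le_mn : (m.*2 <= n)%N.
  rewrite -(ler_nat R) -mul2n natrM.
  have : lambda * n%:R <= 1 / 2 * n%:R by rewrite ler_wpM2r // ltW.
  by move: m_le; lra.
apply: le_trans (small_cancellation_failure_le hQ C_ge0 r_gt0 weight_sqr c_gt0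
  (mass_ge n le_Nn) k m_gt1 le_mn m_le) _.
(* [y] is [r] to the power [lambda * n / 2]. Up to constants and [n%:R ^+ 2], pairs of words
   contribute the square of [k%:R * y] and single words contribute [k%:R * y], so one estimate
   settles both. *)
pose y := expR (rho * (lambda / 2 * n%:R)); pose z := expR (- (gamma * n%:R)).
have y_ge0 : 0 <= y by apply: expR_ge0.
have z_ge0 : 0 <= z by apply: expR_ge0.
have z_le1 : z <= 1.
  by rewrite -expR0 ler_expR oppr_le0 mulr_ge0 // ltW.
have ky_le : k%:R * y <= z by apply: size_le.
have ky_ge0 : 0 <= k%:R * y by rewrite mulr_ge0.
have mS : lambda * n%:R <= m%:R + 1 by rewrite natr1 ltW.
have rm_le : r ^+ m <= expR (- rho) * y ^+ 2.
  rewrite /r /y -!expRM_natl -expRD ler_expR -subr_ge0.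
  rewrite [X in 0 <= X](_ : _ = - rho * (m%:R + 1 - lambda * n%:R)); last by field.
  by rewrite mulr_ge0 ?subr_ge0 // oppr_ge0 ltW.
have rh_le : r ^+ m./2 <= expR (- rho) * y.
  have mE : m%:R = (odd m)%:R + 2 * (m./2)%:R :> R.
    by rewrite -{1}(odd_double_half m) natrD -mul2n natrM.
  have odd_le1 : (odd m)%:R <= 1 :> R by case: (odd m); rewrite ?ler01.
  rewrite /r /y -!expRM_natl -expRD ler_expR -subr_ge0.
  rewrite [X in 0 <= X](_ : _ = - rho * ((m./2)%:R + 1 - lambda / 2 * n%:R)); last by ring.
  by rewrite mulr_ge0 ?oppr_ge0 ?(ltW rho_lt0) //; lra.
have e_ge0 : 0 <= expR (- rho) by apply: expR_ge0.
apply: (@le_trans _ _ (2 * n%:R ^+ 2 * expR (- rho) * (K1 * (k%:R * y) ^+ 2 + K2 * (k%:R * y)))).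
  rewrite [leRHS](_ : _ =
    (k * k * (n * n) * 2)%:R * (K1 * (expR (- rho) * y ^+ 2)) +
    (k * (n * n) * 2)%:R * (K2 * (expR (- rho) * y))); last first.
    by rewrite !natrM; ring.
  apply: lerD; rewrite ler_wpM2l // -mulrA.
    by rewrite /K1 /D -!mulrA !ler_wpM2l ?exprn_ge0.
  by rewrite /K2 /D -!mulrA !ler_wpM2l ?exprn_ge0.
(* Since [z <= 1], squaring only improves the bound. *)
have ky2_le : (k%:R * y) ^+ 2 <= z.
  rewrite expr2; apply: le_trans (ler_piMl ky_ge0 (le_trans ky_le z_le1)) ky_le.
rewrite [leRHS](_ : _ = 2 * n%:R ^+ 2 * expR (- rho) * (K1 * z + K2 * z)); last first.
  by rewrite /z; ring.
rewrite ler_wpM2l ?mulr_ge0 ?exprn_ge0 //.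
by rewrite lerD // ler_wpM2l.
Qed.
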